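(* Given a $\mathrm{PINC}$-formula $\varphi$ containing no occurrence of the disjunction $\lor$, deciding whether $\varphi$ is satisfiable (i.e., whether some non-empty team satisfies $\varphi$) can be done in polynomial time.
   Context: An assignment maps propositional variables to $\{0,1\}$; a team is a finite set of assignments over a common finite set of variables; $s(\mathbf x)=(s(x_1),\dots,s(x_n))$. $\mathrm{PINC}$-formulas: $\varphi ::= \top\mid\bot\mid x\mid\neg x\mid \mathbf x\subseteq\mathbf y\mid\varphi\land\varphi\mid\varphi\lor\varphi$, with $|\mathbf x|=|\mathbf y|$. Semantics: $T\models\top$ always; $T\models\bot$ iff $T=\emptyset$; $T\models x$ (resp. $\neg x$) iff every $t\in T$ has $t(x)=1$ (resp. $0$); $T\models\varphi\land\psi$ iff $T\models\varphi$ and $T\models\psi$; $T\models\mathbf x\subseteq\mathbf y$ iff for every $t\in T$ there is $t'\in T$ with $t(\mathbf x)=t'(\mathbf y)$. *)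

(* Defs.v *)
From Corelib Require Import BinNums.
From HB Require Import structures.
From mathcomp Require Import all_boot all_order all_algebra finmap.
Set Implicit Arguments.
Unset Strict Implicit.
Unset Printing Implicit Defensive.

Notation var := nat.

Inductive formula : Type :=
| FTop
| FBot
| FVar of var
| FNeg of var
| FInc n of n.-tuple var & n.-tuple var
| FAnd of formula & formula
| FOr of formula & formula.

Fixpoint disj_free (phi : formula) : bool :=
  match phi with
  | FAnd phi1 phi2 => disj_free phi1 && disj_free phi2
  | FOr _ _ => false
  | _ => true
  end.

Fixpoint vars (phi : formula) : seq var :=
  match phi with
  | FTop | FBot => [::]
  | FVar x | FNeg x => [:: x]
  | FInc _ xs ys => xs ++ ys
  | FAnd phi1 phi2 | FOr phi1 phi2 => vars phi1 ++ vars phi2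
  end.

Definition assignment (V : {fset var}) := {ffun V -> bool}.

Definition team (V : {fset var}) := {set {ffun V -> bool}}.

(* The default value outside of V is never used by [satisfiable], which
   requires V to contain all the variables of the formula. *)
Definition value (V : {fset var}) (s : assignment V) (x : var) : bool :=
  if insub x is Some v then s v else false.

Definition tvalue (V : {fset var}) (s : assignment V) n (xs : n.-tuple var) :
  n.-tuple bool := map_tuple (value s) xs.

Fixpoint models (V : {fset var}) (T : team V) (phi : formula) : Prop :=
  match phi with
  | FTop => True
  | FBot => T = set0
  | FVar x => forall t, t \in T -> value t x = true
  | FNeg x => forall t, t \in T -> value t x = false
  | FInc _ xs ys =>
      forall t, t \in T -> exists2 t', t' \in T & tvalue t xs = tvalue t' ys
  | FAnd phi1 phi2 => models T phi1 /\ models T phi2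
  | FOr phi1 phi2 =>
      exists T1 T2 : team V, [/\ T = T1 :|: T2, models T1 phi1 & models T2 phi2]
  end.

Definition satisfiable (phi : formula) : Prop :=
  exists (V : {fset var}) (T : team V),
    [/\ {subset vars phi <= V}, T != set0 & models T phi].

Inductive token : Type :=
| TkTop | TkBot | TkX | Tk0 | Tk1 | TkNeg | TkInc | TkAnd | TkOr
| TkOpen | TkClose.

Definition token_code (a : token) : 'I_11 :=
  inord match a with
  | TkTop => 0 | TkBot => 1 | TkX => 2 | Tk0 => 3 | Tk1 => 4 | TkNeg => 5
  | TkInc => 6 | TkAnd => 7 | TkOr => 8 | TkOpen => 9 | TkClose => 10
  end.

Definition token_decode (i : 'I_11) : token :=
  nth TkTop [:: TkTop; TkBot; TkX; Tk0; Tk1; TkNeg; TkInc; TkAnd; TkOr;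
                TkOpen; TkClose] i.

Lemma token_codeK : cancel token_code token_decode.
Proof. by case; rewrite /token_code /token_decode inordK. Qed.

HB.instance Definition _ := Finite.copy token (can_type token_codeK).

(* Most significant digit first. *)
Fixpoint pos_digits (p : positive) : seq token :=
  match p with
  | xH => [:: Tk1]
  | xO q => rcons (pos_digits q) Tk0
  | xI q => rcons (pos_digits q) Tk1
  end.

Definition digits (n : nat) : seq token :=
  if bin_of_nat n is Npos p then pos_digits p else [:: Tk0].

(* Variable number n is the letter x with subscript n written in binary. *)
Definition encode_var (x : var) : seq token := TkX :: digits x.

Definition encode_vars (xs : seq var) : seq token :=
  flatten (map encode_var xs).

Fixpoint encode (phi : formula) : seq token :=
  match phi with
  | FTop => [:: TkTop]
  | FBot => [:: TkBot]
  | FVar x => encode_var x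
  | FNeg x => TkNeg :: encode_var x
  | FInc _ xs ys => encode_vars xs ++ TkInc :: encode_vars ys
  | FAnd phi1 phi2 =>
      TkOpen :: encode phi1 ++ TkAnd :: encode phi2 ++ [:: TkClose]
  | FOr phi1 phi2 =>
      TkOpen :: encode phi1 ++ TkOr :: encode phi2 ++ [:: TkClose]
  end.

Inductive dir : Type := GoLeft | Stay | GoRight.

(* A two-way infinite tape that is blank almost everywhere: the cells to the
   left of the head, nearest first, then the scanned cell followed by the cells
   to its right. Cells beyond the ends of the lists are blank. *)
Record tape (A : Type) : Type := Tape {
  tleft : seq (option A);
  tright : seq (option A)
}.

Definition read (A : Type) (t : tape A) : option A := head None (tright t).

Definition write (A : Type) (a : option A) (t : tape A) : tape A :=
  Tape (tleft t) (a :: behead (tright t)).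

Definition shift (A : Type) (d : dir) (t : tape A) : tape A :=
  match d with
  | GoLeft => Tape (behead (tleft t)) (head None (tleft t) :: tright t)
  | Stay => t
  | GoRight => Tape (read t :: tleft t) (behead (tright t))
  end.

(* There are [extra.+1] tapes, tape [ord0] being the input tape. Their letters
   are the input letters, the letters of [work], and the blank [None]. The
   halting states are those whose [verdict] is [Some b], with answer [b]. *)
Record machine (Sigma : finType) : Type := Machine {
  work : finType;
  extra : nat;
  state : finType;
  start : state;
  verdict : state -> option bool;
  delta : state -> {ffun 'I_extra.+1 -> option (Sigma + work)} ->
          state * {ffun 'I_extra.+1 -> option (Sigma + work) * dir}
}.

Record config (Sigma : finType) (M : machine Sigma) : Type := Config {
  cstate : state M;
  ctapes : {ffun 'I_(extra M).+1 -> tape (Sigma + work M)}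
}.

Definition init (Sigma : finType) (M : machine Sigma) (w : seq Sigma) :
  config M :=
  Config (start M)
    [ffun i => Tape [::] (if i == ord0 then [seq Some (inl a) | a <- w]
                          else [::])].

Definition step (Sigma : finType) (M : machine Sigma) (c : config M) :
  config M :=
  if verdict (cstate c) is Some _ then c else
  let: (q, acts) := delta (cstate c) [ffun i => read (ctapes c i)] in
  Config q [ffun i => shift (acts i).2 (write (acts i).1 (ctapes c i))].

Definition outcome (Sigma : finType) (M : machine Sigma) (w : seq Sigma)
  (n : nat) : option bool :=
  verdict (cstate (iter n (@step Sigma M) (init M w))).

(* The decision problem whose instances are the x in [dom], presented to the
   machine as the words [enc x], and whose positive instances are the x in
   [dom] satisfying [P]. *)
Definition polytime_decidable (X : Type) (Sigma : finType)
  (enc : X -> seq Sigma) (dom : X -> Prop) (P : X -> Prop) : Prop :=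
  exists (M : machine Sigma) (p : {poly nat}), forall x : X, dom x ->
    exists2 b : bool, outcome M (enc x) (p.[size (enc x)])%R = Some b
                    & (b <-> P x).

(* Main.v *)
From HB Require Import structures.
Require Import Defs.
From mathcomp Require Import all_boot all_order all_algebra finmap.
From mathcomp Require Import zify.

(* Call true and false together with the variables the terms. Every atom of a
   disjunction-free formula amounts to a list of pairs (x, y) of terms, true in T
   when each t in T has a t' in T with t(x) = t'(y) for all these pairs at once:
   the literal x is the pair (x, true), bottom is the pair (false, true), and
   (true, true), (false, false) can always be added. If y and y' agree throughout
   T then so do x and x' for any two pairs (x, y), (x', y') of an atom. Conversely, if a labelling f of the terms
   satisfies all the clauses (f y = f y' implies f x = f x') and separates true
   from false, then the team of all assignments that factor through f satisfies
   the formula. So the formula is satisfiable iff the clauses do not derive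
   true = false. This is decided by taking a clause whose premise is a syntactic
   identity, deleting it, and substituting one side of its conclusion for the
   other everywhere, until no such clause is left.

   The machine uses its tapes as stacks, the top of a stack being under the head. *)

Set Implicit Arguments.
Unset Strict Implicit.
Unset Printing Implicit Defensive.

(** * Stack programs and their compilation *)

Notation stacks := (seq (seq token)).
Notation tops := (seq (option token)).

(** Tests and commands depend only on the tops of the stacks, which is all that the heads of a
    machine can read. *)
Inductive cmd : Type :=
| Skip
| Push of nat & token
| Copy of nat & nat
| Pop of nat
| Seq of cmd & cmd
| If of (tops -> bool) & cmd & cmd
| While of (tops -> bool) & cmd.

Notation "c1 ;; c2" := (Seq c1 c2) (at level 60, right associativity).
Notation upd := (set_nth [::]).

(* [exec c S n S']: started on the stacks S, the command c ends on the stacks S'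
   after at most n steps of the compiled machine. *)
Inductive exec : cmd -> stacks -> nat -> stacks -> Prop :=
| exec_skip S : exec Skip S 1 S
| exec_push S i a : i < size S ->
    exec (Push i a) S 2 (upd S i (a :: nth [::] S i))
| exec_copy S i j a s : nth [::] S i = a :: s -> j < size S ->
    exec (Copy i j) S 2 (upd S j (a :: nth [::] S j))
| exec_pop S i : i < size S ->
    exec (Pop i) S 1 (upd S i (behead (nth [::] S i)))
| exec_seq c1 c2 S S1 S2 n1 n2 : exec c1 S n1 S1 -> exec c2 S1 n2 S2 ->
    exec (c1 ;; c2) S (n1 + n2) S2
| exec_if (t : tops -> bool) c1 c2 S S' n :
    exec (if t (map ohead S) then c1 else c2) S n S' ->
    exec (If t c1 c2) S n.+1 S'
| exec_while_end (t : tops -> bool) c S : ~~ t (map ohead S) ->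
    exec (While t c) S 1 S
| exec_while_loop (t : tops -> bool) c S S1 S2 n1 n2 : t (map ohead S) ->
    exec c S n1 S1 -> exec (While t c) S1 n2 S2 ->
    exec (While t c) S (n1 + n2).+1 S2
| exec_le c S n m S' : exec c S n S' -> n <= m -> exec c S m S'.

Lemma exec_size c S n S' : exec c S n S' -> size S' = size S.
Proof.
elim=> //=.
- by move=> {}S i a lti; rewrite size_set_nth; apply/maxn_idPr.
- by move=> {}S i j a s _ lti; rewrite size_set_nth; apply/maxn_idPr.
- by move=> {}S i lti; rewrite size_set_nth; apply/maxn_idPr.
- by move=> c1 c2 {}S S1 S2 n1 n2 _ e1 _ e2; rewrite e2 e1.
- by move=> t {}c {}S S1 S2 n1 n2 _ _ e1 _ e2; rewrite e2 e1.
Qed.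

(** These are the control states of the compiled command. A push takes two steps, moving the head
    left and then writing, so [Push] has two positions; [Copy] must also remember the letter it read
    before the move. *)
Fixpoint pos (c : cmd) : finType :=
  match c with
  | Skip | Pop _ => unit
  | Push _ _ => bool
  | Copy _ _ => option token
  | Seq c1 c2 => (pos c1 + pos c2)%type
  | If _ c1 c2 => option (pos c1 + pos c2)%type
  | While _ c => option (pos c)
  end.

Fixpoint entry (c : cmd) : pos c :=
  match c return pos c with
  | Skip | Pop _ => tt
  | Push _ _ => false
  | Copy _ _ => None
  | Seq c1 _ => inl (entry c1)
  | If _ _ _ => None
  | While _ _ => None
  end.

Notation act := (nat * option token * dir)%type.

Definition noop (o : tops) : act := (0, nth None o 0, Stay).

(* The position [None] means that the command is finished. *)
Fixpoint next (c : cmd) : pos c -> tops -> option (pos c) * act :=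
  match c return pos c -> tops -> option (pos c) * act with
  | Skip => fun _ o => (None, noop o)
  | Pop i => fun _ o => (None, (i, None, GoRight))
  | Push j a => fun q o =>
      if q then (None, (j, Some a, Stay))
      else (Some true, (j, nth None o j, GoLeft))
  | Copy i j => fun q o =>
      if q is Some a then (None, (j, Some a, Stay))
      (* The default letter is harmless: [exec_copy] only speaks of a nonempty source. *)
      else (Some (Some (odflt TkX (nth None o i))), (j, nth None o j, GoLeft))
  | Seq c1 c2 => fun q o =>
      match q with
      | inl q1 => let: (r, x) := next q1 o in
          (Some (if r is Some q' then inl q' else inr (entry c2)), x)
      | inr q2 => let: (r, x) := next q2 o in (omap inr r, x)
      end
  | If t c1 c2 => fun q o =>
      match q with
      | None => (Some (Some (if t o then inl (entry c1) else inr (entry c2))),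
                 noop o)
      | Some (inl q1) => let: (r, x) := next q1 o in
          (omap (fun q' => Some (inl q')) r, x)
      | Some (inr q2) => let: (r, x) := next q2 o in
          (omap (fun q' => Some (inr q')) r, x)
      end
  | While t c => fun q o =>
      match q with
      | None => (if t o then Some (Some (entry c)) else None, noop o)
      | Some q1 => let: (r, x) := next q1 o in (Some r, x)
      end
  end.

(** * Simulation of stack programs by a multi-tape machine *)

Section Compile.

Variable k : nat.

Notation letter := (token + void)%type.
Notation tapes := {ffun 'I_k.+1 -> tape letter}.

Definition to_letter (o : option token) : option letter := omap inl o.

Definition of_letter (o : option letter) : option token :=
  if o is Some (inl a) then Some a else None.

Definition observe (r : 'I_k.+1 -> option letter) : tops :=
  [seq of_letter (r i) | i <- enum 'I_k.+1].

Definition acts (x : act) (r : 'I_k.+1 -> option letter) :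
  {ffun 'I_k.+1 -> option letter * dir} :=
  [ffun i : 'I_k.+1 => if i == x.1.1 :> nat then (to_letter x.1.2, x.2) else (r i, Stay)].

Definition apply_acts (x : act) (t : tapes) : tapes :=
  [ffun i : 'I_k.+1 => let y := acts x (fun j => read (t j)) i in
             shift y.2 (write y.1 (t i))].

(* Trailing blanks appear when the machine rewrites a blank below a stack. *)
Definition holds (t : tape letter) (s : seq token) : Prop :=
  exists m, tright t = [seq Some (inl a) | a <- s] ++ nseq m None.

Definition represents (t : tapes) (S : stacks) : Prop :=
  size S = k.+1 /\ forall i, holds (t i) (nth [::] S i).

Lemma observe_represents t S : represents t S ->
  observe (fun i => read (t i)) = map ohead S.
Proof.
case=> sS tS; apply: (@eq_from_nth _ None).
  by rewrite /observe size_map size_enum_ord size_map sS.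
rewrite /observe size_map size_enum_ord => i lti.
rewrite (nth_map (Ordinal lti)) ?size_enum_ord // (nth_map [::]) ?sS //.
have -> : nth (Ordinal lti) (enum 'I_k.+1) i = Ordinal lti.
  by apply: val_inj; rewrite /= nth_enum_ord.
have [m] := tS (Ordinal lti).
rewrite /read /= => ->.
by case: (nth _ _ _) => [|a s] //=; case: m.
Qed.

Lemma holds_rewrite t s : holds t s -> holds (write (read t) t) s.
Proof.
case=> m e; rewrite /holds /write /read /= e.
case: s {e} => [|a s] /=; last by exists m.
by case: m => [|m]; [exists 1 | exists m.+1].
Qed.

Inductive runs (c : cmd) : nat -> pos c -> tapes -> tapes -> Prop :=
| runs_exit q (t : tapes) x : next q (observe (fun i => read (t i))) = (None, x) ->
    runs 1 q t (apply_acts x t)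
| runs_step n q q' (t t' : tapes) x :
    next q (observe (fun i => read (t i))) = (Some q', x) ->
    runs n q' (apply_acts x t) t' -> runs n.+1 q t t'.

Lemma runs_seq c1 c2 n m q t t' t'' :
  runs n q t t' -> runs m (entry c2) t' t'' ->
  @runs (c1 ;; c2) (n + m) (inl q) t t''.
Proof.
have inr_runs m' q' u u' : runs m' q' u u' -> @runs (c1 ;; c2) m' (inr q') u u'.
  elim=> [{}q' {}u x e|n' {}q' q'' {}u {}u' x e _ ih].
    by apply: runs_exit; rewrite /= e.
  by apply: (@runs_step (c1 ;; c2) _ _ (inr q'') _ _ x) => //=; rewrite e.
elim=> [{}q {}t x e|{}n {}q q' {}t {}t' x e _ ih] r2.
  apply: (@runs_step (c1 ;; c2) _ _ (inr (entry c2)) _ _ x); first by rewrite /= e.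
  exact: inr_runs.
apply: (@runs_step (c1 ;; c2) _ _ (inl q') _ _ x); first by rewrite /= e.
exact: ih.
Qed.

Lemma runs_ifl t c1 c2 n q u u' :
  runs n q u u' -> @runs (If t c1 c2) n (Some (inl q)) u u'.
Proof.
elim=> [{}q {}u x e|{}n {}q q' {}u {}u' x e _ ih].
  by apply: runs_exit; rewrite /= e.
by apply: (@runs_step (If t c1 c2) _ _ (Some (inl q')) _ _ x) => //=; rewrite e.
Qed.

Lemma runs_ifr t c1 c2 n q u u' :
  runs n q u u' -> @runs (If t c1 c2) n (Some (inr q)) u u'.
Proof.
elim=> [{}q {}u x e|{}n {}q q' {}u {}u' x e _ ih].
  by apply: runs_exit; rewrite /= e.
by apply: (@runs_step (If t c1 c2) _ _ (Some (inr q')) _ _ x) => //=; rewrite e.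
Qed.

Lemma runs_while t c n m q u u' u'' :
  runs n q u u' -> @runs (While t c) m None u' u'' ->
  @runs (While t c) (n + m) (Some q) u u''.
Proof.
elim=> [{}q {}u x e|{}n {}q q' {}u {}u' x e _ ih] r2.
  by apply: (@runs_step (While t c) _ _ None _ _ x) => //=; rewrite e.
by apply: (@runs_step (While t c) _ _ (Some q') _ _ x); [rewrite /= e | exact: ih].
Qed.

Lemma apply_noop t S : represents t S ->
  represents (apply_acts (noop (observe (fun i => read (t i)))) t) S.
Proof.
move=> rt; split=> [|i]; first by case: rt.
rewrite ffunE /= ffunE /=; case: ifP => [/eqP i0|_] /=; last first.
  by apply: holds_rewrite; case: rt.
rewrite (observe_represents rt).
have -> : to_letter (nth None (map ohead S) 0) = read (t i).
  have [m] := rt.2 i; rewrite i0 /read => ->.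
  rewrite (nth_map [::]) ?rt.1 //.
  by case: (nth _ _ _) => [|a s] //=; case: m.
by apply: holds_rewrite; case: rt.
Qed.

Lemma represents_set (t t' : tapes) S i s : represents t S -> i < size S ->
  (forall j : 'I_k.+1, j = i :> nat -> holds (t' j) s) ->
  (forall j : 'I_k.+1, j != i :> nat -> t' j = write (read (t j)) (t j)) ->
  represents t' (upd S i s).
Proof.
move=> [sS tS] lti ti tj; split.
  by rewrite size_set_nth sS; apply/maxn_idPr; rewrite -sS.
move=> j; rewrite nth_set_nth /=; case: (eqVneq (j : nat) i) => [/ti //|ne].
by rewrite tj //; apply: holds_rewrite.
Qed.

Lemma apply_pop t S i : represents t S -> i < size S ->
  represents (apply_acts (i, None, GoRight) t) (upd S i (behead (nth [::] S i))).
Proof.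
move=> rt lti; apply: (represents_set rt) => // j ji; rewrite ffunE /= ffunE /=.
  rewrite ji eqxx /= -ji; have [m e] := rt.2 j; rewrite /holds /= e.
  case: (nth _ _ _) => [|a s] /=; last by exists m.
  by case: m {e} => [|m]; [exists 0 | exists m].
by rewrite (negPf ji).
Qed.

(** The cell entered on the left may contain anything, since the second action overwrites it; hence
    [holds] says nothing about the left part of a tape. *)
Lemma apply_push t S i a : represents t S -> i < size S ->
  let o := observe (fun i => read (t i)) in
  represents (apply_acts (i, Some a, Stay)
                (apply_acts (i, nth None o i, GoLeft) t))
             (upd S i (a :: nth [::] S i)).
Proof.
move=> rt lti o; apply: (represents_set rt) => // j ji;
  rewrite !(ffunE, fun_if) /=.
  rewrite ji !eqxx /= -ji /o (observe_represents rt).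
  have [m e] := rt.2 j; rewrite /holds /= e (nth_map [::]) ?ji // -?ji.
  case: (nth _ _ _) => [|b s] /=; last by exists m.
  by case: m {e} => [|m]; [exists 1 | exists m.+1].
by rewrite (negPf ji).
Qed.

(** Induction on the execution. The exact count m may stay below n because [exec_le] allows slack,
    whereas [runs] counts every step. *)
Lemma exec_runs c S n S' : exec c S n S' -> forall t, represents t S ->
  exists m t', [/\ m <= n, represents t' S' & runs m (entry c) t t'].
Proof.
elim=> {c S n S'}.
- move=> S t rt; exists 1; eexists; split=> //.
    exact: (apply_noop rt).
  by apply: runs_exit.
- move=> S i a lti t rt; exists 2; eexists; split=> //.
    exact: (apply_push a rt lti).
  by apply: runs_step => //=; apply: runs_exit.
- move=> S i j a s e lti t rt; exists 2; eexists; split=> //.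
    exact: (apply_push a rt lti).
  apply: runs_step => //=; apply: runs_exit.
  rewrite (observe_represents rt) (nth_map [::]) /= ?e //.
  by case: ltnP e => // le; rewrite nth_default.
- move=> S i lti t rt; exists 1; eexists; split=> //.
    exact: (apply_pop rt lti).
  by apply: runs_exit.
- move=> c1 c2 S S1 S2 n1 n2 _ ih1 _ ih2 t /ih1 [m1 [t1 [l1 /ih2 H r1]]].
  have [m2 [t2 [l2 rt2 r2]]] := H.
  exists (m1 + m2), t2; split=> //; first exact: leq_add.
  exact: runs_seq r1 r2.
- move=> b c1 c2 S S' n _ ih t rt.
  have [m [t' [l rt' r]]] := ih _ (apply_noop rt).
  exists m.+1, t'; split=> //.
  apply: runs_step => //=; rewrite {1}(observe_represents rt).
  by case: (b _) r => r; [apply: runs_ifl | apply: runs_ifr].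
- move=> b c S nb t rt; exists 1; eexists; split=> //.
    exact: (apply_noop rt).
  by apply: runs_exit; rewrite /= {1}(observe_represents rt) (negPf nb).
- move=> b c S S1 S2 n1 n2 bS _ ih1 _ ih2 t rt.
  have [m1 [t1 [l1 /ih2 H r1]]] := ih1 _ (apply_noop rt).
  have [m2 [t2 [l2 rt2 r2]]] := H.
  exists (m1 + m2).+1, t2; split=> //; first by rewrite ltnS leq_add.
  apply: (@runs_step (While b c) _ _ (Some (entry c))).
    by rewrite /= {1}(observe_represents rt) bS.
  exact: runs_while r1 r2.
- move=> c S n m S' _ ih le t /ih [m' [t' [l rt' r]]].
  by exists m', t'; split=> //; apply: leq_trans le.
Qed.

Variables (c : cmd) (answer : tops -> bool).

(** When the command is finished, one further step from [inr None] turns the tops of the stacks into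
    the halting state [inr (Some b)]. Stacks carry tokens only, hence the empty work alphabet. *)
Definition compile : machine token := {|
  work := void;
  extra := k;
  state := (pos c + option bool)%type;
  start := inl (entry c);
  verdict := fun q => if q is inr b then b else None;
  delta := fun q r =>
    let o := observe r in
    match q with
    | inl q1 => let: (q', x) := next q1 o in
        (if q' is Some q2 then inl q2 else inr None, acts x r)
    | inr _ => (inr (Some (answer o)), acts (noop o) r)
    end |}.

Lemma compile_step q1 (t : tapes) q' x :
  next q1 (observe (fun i => read (t i))) = (q', x) ->
  @step _ compile (@Config _ compile (inl q1) t) =
  @Config _ compile (if q' is Some q2 then inl q2 else inr None)
          (apply_acts x t).
Proof.
have eo : observe [ffun i => read (t i)] = observe (fun i => read (t i)).
  by apply: eq_map => i; rewrite ffunE.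
move=> e; rewrite /step /= eo e; congr Config.
by apply/ffunP => i; rewrite !ffunE.
Qed.

Lemma compile_runs n q (t t' : tapes) : @runs c n q t t' ->
  iter n (@step _ compile) (@Config _ compile (inl q) t) =
  @Config _ compile (inr None) t'.
Proof.
elim=> [{}q {}t x e|{}n {}q q' {}t {}t' x e _ ih]; first exact: compile_step e.
by rewrite iterSr (compile_step e).
Qed.

Lemma compile_halted (s : config compile) n : verdict (cstate s) ->
  iter n (@step _ compile) s = s.
Proof. by move=> h; elim: n => //= n ->; rewrite /step; case: (verdict _) h. Qed.

(** The strict bound leaves room for the step that computes the answer; a halted machine no longer
    moves, so every later time shows the same outcome. *)
Lemma compile_outcome (w : seq token) n m S' :
  exec c (w :: nseq k [::]) n S' -> n < m ->
  outcome compile w m = Some (answer (map ohead S')).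
Proof.
move=> ex lt_nm.
have rt : represents (ctapes (init compile w)) (w :: nseq k [::]).
  split=> [|i]; first by rewrite /= size_nseq.
  rewrite ffunE; exists 0; rewrite cats0 /=.
  by case: (unliftP ord0 i) => [j ->|->] //=; rewrite nth_nseq if_same.
have [n' [t' [le_n rt' r]]] := exec_runs ex rt.
rewrite /outcome -(subnK (leq_ltn_trans le_n lt_nm)) iterD iterS.
have -> : init compile w = @Config _ compile (inl (entry c))
  (ctapes (init compile w)) by [].
rewrite (compile_runs r) compile_halted //=.
congr (Some (answer _)); rewrite -(observe_represents rt').
by apply: eq_map => i; rewrite ffunE.
Qed.

End Compile.

(** * Satisfiability as consistency of equational clauses *)

Section Horn.

Variable W : countType.

(* The clause ((a, b), (c, d)) reads: if a = b then c = d. *)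
Notation clause := ((W * W) * (W * W))%type.

Definition respects (f : W -> nat) (K : seq clause) : Prop :=
  forall k, k \in K -> f k.1.1 = f k.1.2 -> f k.2.1 = f k.2.2.

(** This is the semantic form of the statement that the clauses do not derive [u = v]. *)
Definition consistent (K : seq clause) (u v : W) : Prop :=
  exists2 f, respects f K & f u <> f v.

Definition subst (c d w : W) : W := if w == c then d else w.

Definition map_clause (V : Type) (f : W -> V) (k : clause) :=
  ((f k.1.1, f k.1.2), (f k.2.1, f k.2.2)).

Lemma respects_cat f K1 K2 :
  respects f (K1 ++ K2) <-> respects f K1 /\ respects f K2.
Proof.
split=> [h|[h1 h2] k]; last by rewrite mem_cat => /orP[/h1|/h2].
by split=> k kK; apply: h; rewrite mem_cat kK ?orbT.
Qed.

(** The trivial premise forces c and d to share a label, so a labelling of the left side is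
    unchanged by [subst c d]. Conversely, a labelling of the substituted clauses is composed with
    [subst c d]. *)
Lemma consistent_fire K1 K2 a c d u v :
  consistent (K1 ++ (a, a, (c, d)) :: K2) u v <->
  consistent (map (map_clause (subst c d)) (K1 ++ K2))
             (subst c d u) (subst c d v).
Proof.
have mem_fire k : (k \in K1 ++ (a, a, (c, d)) :: K2) =
    (k == (a, a, (c, d))) || (k \in K1 ++ K2).
  by rewrite !mem_cat inE orbCA.
split=> -[f rf fuv].
  have fs w : f (subst c d w) = f w.
    rewrite /subst; case: eqP => // ->; apply/esym.
    by apply: (rf (a, a, (c, d))); rewrite ?mem_fire ?eqxx.
  exists f; last by rewrite !fs.
  by move=> _ /mapP [k kK ->]; rewrite /= !fs; apply: rf; rewrite mem_fire kK orbT.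
exists (f \o subst c d) => // k; rewrite mem_fire => /orP[/eqP -> _ /=|kK].
  by rewrite /subst eqxx; case: eqP.
by apply: (rf (map_clause (subst c d) k)); apply: map_f.
Qed.

(** An injective labelling falsifies every premise that is not an identity; one with values in [nat]
    exists because [W] is countable. *)
Lemma consistent_end K u v : all (fun k => k.1.1 != k.1.2) K ->
  consistent K u v <-> u != v.
Proof.
move=> /allP nK; split=> [[f _ fuv]|uv]; first by apply/eqP => euv; rewrite euv in fuv.
exists choice.pickle => [k kK /(pcan_inj choice.pickleK) /eqP|/(pcan_inj choice.pickleK) /eqP].
  by rewrite (negPf (nK _ kK)).
by rewrite (negPf uv).
Qed.

Notation pairs := (seq (W * W)).

Definition clause_of (p q : W * W) : clause := (p.2, q.2, (p.1, q.1)).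

(** Only p before q is considered: a pair gives nothing against itself, and the clause of q and p is
    equivalent to that of p and q by symmetry of equality. *)
Fixpoint gen (ps : pairs) (acc : seq clause) : seq clause :=
  if ps is p :: r then gen r ([seq clause_of p q | q <- r] ++ acc) else acc.

Lemma respects_gen f ps acc : respects f (gen ps acc) <->
  respects f acc /\
  forall p q, p \in ps -> q \in ps -> f p.2 = f q.2 -> f p.1 = f q.1.
Proof.
elim: ps acc => [|p r ih] acc /=; first by split=> [|[]].
rewrite ih respects_cat; split=> [[[h1 h2] h3]|[h1 h2]].
  have hp q : q \in r -> f p.2 = f q.2 -> f p.1 = f q.1.
    by move=> qr; apply: (h1 (clause_of p q)); apply: map_f.
  split=> // q q'; rewrite !inE => /orP[/eqP ->|qr] /orP[/eqP ->|q'r] //.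
  - exact: hp.
  - by move/esym/hp => ->.
  - exact: h3.
split; first (split=> //).
  by move=> _ /mapP [q qr ->] /=; apply: h2; rewrite inE ?eqxx ?qr ?orbT.
by move=> q q' qr q'r; apply: h2; rewrite inE ?qr ?q'r orbT.
Qed.

End Horn.

Notation clause W := ((W * W) * (W * W))%type.

(** * Atoms as lists of pairs of terms *)

Notation term := (var + bool)%type.

Definition atom_pairs (phi : formula) : seq (term * term) :=
  match phi with
  | FTop => [:: (inr true, inr true)]
  | FBot => [:: (inr false, inr true)]
  | FVar x => [:: (inl x, inr true)]
  | FNeg x => [:: (inl x, inr false)]
  | FInc _ xs ys => zip (map inl xs) (map inl ys)
  | _ => [::]
  end.

Definition const_pairs (W : Type) (c : bool -> W) : seq (W * W) :=
  [:: (c true, c true); (c false, c false)].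

(** The accumulator follows the order in which the machine pushes clauses, so that its output stack
    encodes exactly this list. *)
Fixpoint clauses (phi : formula) (acc : seq (clause term)) : seq (clause term) :=
  match phi with
  | FAnd phi1 phi2 => clauses phi2 (clauses phi1 acc)
  | _ => if atom_pairs phi is [::] then acc
         else gen (const_pairs inr ++ atom_pairs phi) acc
  end.

Definition tval (V : {fset var}) (t : assignment V) (u : term) : bool :=
  match u with inl x => value t x | inr b => b end.

Definition models_pairs (V : {fset var}) (T : team V) (ps : seq (term * term)) :=
  forall t, t \in T -> exists2 t', t' \in T &
    forall p, p \in ps -> tval t p.1 = tval t' p.2.

Lemma mem_zip (T1 T2 : eqType) (s1 : seq T1) (s2 : seq T2) p :
  p \in zip s1 s2 -> p.1 \in s1 /\ p.2 \in s2.
Proof.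
elim: s1 s2 => [|x s1 ih] [|y s2] //=; rewrite !inE.
by case/orP=> [/eqP ->|/ih [-> ->]]; rewrite ?eqxx ?orbT.
Qed.

Lemma tvalue_eq (V : {fset var}) (t t' : assignment V) n (xs ys : n.-tuple var) :
  tvalue t xs = tvalue t' ys <->
  (forall p, p \in zip (map inl xs) (map inl ys) -> tval t p.1 = tval t' p.2).
Proof.
split=> [/(congr1 val) /= e p|h].
  case: xs ys e => xs /= /eqP <- [ys /= /eqP]; elim: xs ys => [|x xs ih] [|y ys] //=.
  move=> [/ih {}ih] [e /ih {}ih]; rewrite inE => /orP[/eqP -> //|]; exact: ih.
apply: val_inj => /=.
case: xs ys h => xs /= /eqP <- [ys /= /eqP]; elim: xs ys => [|x xs ih] [|y ys] //=.
move=> [/ih {}ih] h; rewrite ih.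
  by move: (h (inl x, inl y)) => /=; rewrite inE eqxx => ->.
by move=> p pin; apply: h; rewrite inE pin orbT.
Qed.

Lemma models_atom (V : {fset var}) (T : team V) phi : disj_free phi ->
  (if phi is FAnd _ _ then False else True) ->
  models T phi <-> models_pairs T (const_pairs inr ++ atom_pairs phi).
Proof.
have cst t t' p : p \in const_pairs (@inr var bool) ->
    tval (V := V) t p.1 = tval (V := V) t' p.2.
  by rewrite !inE => /orP[] /eqP ->.
have red ps : models_pairs T (const_pairs inr ++ ps) <-> models_pairs T ps.
  split=> h t /h [t' t'T ht]; exists t' => // p.
    by move=> pin; apply: ht; rewrite mem_cat pin orbT.
  by rewrite mem_cat => /orP[/cst|/ht].
rewrite red {red cst}; case: phi => //=.
- by split=> // _ t tT; exists t => // p; rewrite inE => /eqP ->.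
- split=> [->|h]; first by move=> t; rewrite inE.
  apply/setP => t; rewrite inE; apply/negbTE/negP => /h [t' _ /(_ _ (mem_head _ _))].
  by [].
- move=> x _ _; split=> h t /[dup] tT /h.
    by move=> e; exists t => // p; rewrite inE => /eqP ->.
  by case=> t' _ /(_ _ (mem_head _ _)).
- move=> x _ _; split=> h t /[dup] tT /h.
    by move=> e; exists t => // p; rewrite inE => /eqP ->.
  by case=> t' _ /(_ _ (mem_head _ _)).
- move=> n xs ys _ _; split=> h t /h [t' t'T e]; exists t' => //; exact/tvalue_eq.
Qed.

(* An atom without pairs yields no clause, which is harmless. *)
Lemma respects_atom f phi acc : (if phi is FAnd _ _ then False else True) ->
  f (inr true) <> f (inr false) ->
  respects f (clauses phi acc) <-> respects f acc /\
  forall p q, p \in const_pairs inr ++ atom_pairs phi ->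
    q \in const_pairs inr ++ atom_pairs phi -> f p.2 = f q.2 -> f p.1 = f q.1.
Proof.
move=> na ntf.
have -> : clauses phi acc = if atom_pairs phi is [::] then acc
         else gen (const_pairs inr ++ atom_pairs phi) acc by case: phi na.
case: (atom_pairs phi) => [|p ps]; last exact: respects_gen.
rewrite cats0; split=> [h|[]] //; split=> // p q.
by rewrite !inE => /orP[]/eqP -> /orP[]/eqP ->.
Qed.

Lemma respects_acc f phi acc : respects f (clauses phi acc) -> respects f acc.
Proof.
elim: phi acc => [||x|x|n xs ys|phi1 ih1 phi2 ih2|phi1 _ phi2 _] acc //.
- by move/respects_gen => [].
- by move/respects_gen => [].
- by move/respects_gen => [].
- by move/respects_gen => [].
- by rewrite /clauses; case: (atom_pairs _) => // p ps /respects_gen [].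
- by move=> /= /ih2/ih1.
Qed.

(** * From a satisfying team to a labelling *)

Section FromTeam.

Variables (V : {fset var}) (T : team V).

(** The label codes the column of [u] in the table of values over [T]; the conjunct [t \in T] makes
    the values outside [T] irrelevant. *)
Definition column (u : term) : nat := choice.pickle [ffun t => (t \in T) && tval t u].

Lemma columnP u v : column u = column v <-> {in T, forall t, tval t u = tval t v}.
Proof.
split=> [/(pcan_inj choice.pickleK) /ffunP e t tT|e].
  by have := e t; rewrite !ffunE tT.
congr choice.pickle; apply/ffunP => t; rewrite !ffunE.
by case: (boolP (t \in T)) => //= /e.
Qed.

(** The values of both first coordinates at t are those of the second coordinates at one common t',
    where these agree. *)
Lemma column_closed ps : models_pairs T ps -> forall p q, p \in ps -> q \in ps ->
  column p.2 = column q.2 -> column p.1 = column q.1.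
Proof.
move=> m p q pin qin /columnP e; apply/columnP => t /m [t' t'T h].
by rewrite !h // e.
Qed.

Lemma respects_column phi acc : disj_free phi -> T != set0 -> models T phi ->
  respects column acc -> respects column (clauses phi acc).
Proof.
move=> + /set0Pn [t0 t0T].
(* Nonemptiness of the team enters here: any row separates the two constant columns. *)
have ntf : column (inr true) <> column (inr false).
  by move/columnP/(_ _ t0T).
elim: phi acc => [||x|x|n xs ys|phi1 ih1 phi2 ih2|] acc // df m racc;
  do ?[by apply/respects_atom => //; split=> //; apply: column_closed;
          apply/models_atom].
by move: df m => /= /andP[d1 d2] [m1 m2]; apply/ih2/ih1.
Qed.

End FromTeam.

(** * From a labelling to a satisfying team *)

Section ToTeam.

Variables (f : term -> nat) (V : {fset var}).
Hypothesis ntf : f (inr true) <> f (inr false).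

Definition support : seq term :=
  [:: inr true; inr false] ++ map inl (enum_fset V).

(** These are the assignments that factor through [f], expressed as a finite check on the constants
    and the variables of [V]. *)
Definition max_team : team V :=
  [set t | all (fun u => all (fun v => (f u == f v) ==> (tval t u == tval t v))
                             support) support].

Lemma max_teamP t : reflect {in support &, forall u v, f u = f v ->
  tval t u = tval t v} (t \in max_team).
Proof.
rewrite inE; apply: (iffP allP) => [h u v us vs e|h u us].
  by have /allP/(_ _ vs) := h _ us; rewrite e eqxx => /eqP.
by apply/allP => v vs; apply/implyP => /eqP e; apply/eqP/h.
Qed.

Definition labelled (h : nat -> bool) : assignment V :=
  [ffun x => h (f (inl (val x)))].

(** The values of the constants are fixed in advance, so [h] has to be right at their two labels. *)
Lemma labelledE (h : nat -> bool) u : h (f (inr true)) -> ~~ h (f (inr false)) ->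
  u \in support -> tval (labelled h) u = h (f u).
Proof.
move=> ht hf; rewrite mem_cat !inE -orbA => /or3P[/eqP -> //|/eqP ->|].
  by rewrite (negPf hf).
case/mapP=> x xV -> /=; rewrite /value insubT /=; by rewrite ffunE.
Qed.

Lemma labelled_max_team (h : nat -> bool) : h (f (inr true)) -> ~~ h (f (inr false)) ->
  labelled h \in max_team.
Proof.
by move=> ht hf; apply/max_teamP => u v us vs e; rewrite !labelledE // e.
Qed.

Lemma max_team_neq0 : max_team != set0.
Proof.
apply/set0Pn; exists (labelled (pred1 (f (inr true)))).
by apply: labelled_max_team => /=; rewrite // eq_sym; apply/eqP.
Qed.

(** Given t, the witness t' is induced by the function h on labels that takes at the label of p.2
    the value of p.1 under t. This is well defined: if p.2 and q.2 share a label, so do p.1 and q.1,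
    and t respects labels. *)
Lemma max_team_pairs ps :
  {subset const_pairs inr <= ps} ->
  (forall p, p \in ps -> p.1 \in support /\ p.2 \in support) ->
  (forall p q, p \in ps -> q \in ps -> f p.2 = f q.2 -> f p.1 = f q.1) ->
  models_pairs max_team ps.
Proof.
move=> cps sps hps t /max_teamP tT.
pose h l := has (fun p => (f p.2 == l) && tval t p.1) ps.
have hE p : p \in ps -> h (f p.2) = tval t p.1.
  move=> pin; apply/hasP/idP => [[q qin /andP[/eqP e qv]]|pv]; last first.
    by exists p; rewrite ?eqxx.
  rewrite -(tT q.1 p.1) //; first by case: (sps _ qin).
    by case: (sps _ pin).
  exact: hps.
(* The constant pairs serve to give h the right values at the labels of the constants. *)
have ht : h (f (inr true)) by rewrite (hE (inr true, inr true)) // cps ?inE.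
have hf : ~~ h (f (inr false)) by rewrite (hE (inr false, inr false)) // cps ?inE.
exists (labelled h); first exact: labelled_max_team.
by move=> p pin; rewrite labelledE ?hE //; case: (sps _ pin).
Qed.

(** One team serves all conjuncts at once, since it depends on [f] and [V] only. *)
Lemma max_team_models phi acc : disj_free phi -> {subset vars phi <= V} ->
  respects f (clauses phi acc) -> models max_team phi.
Proof.
have sup x : x \in V -> inl x \in support.
  by move=> xV; rewrite mem_cat; apply/orP; right; apply: map_f.
have csup p : p \in const_pairs inr -> p.1 \in support /\ p.2 \in support.
  by rewrite !inE => /orP[]/eqP ->.
have main psi acc' : disj_free psi -> (if psi is FAnd _ _ then False else True) ->
    (forall p, p \in atom_pairs psi -> p.1 \in support /\ p.2 \in support) ->
    respects f (clauses psi acc') -> models max_team psi.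
  move=> df na sp /respects_atom [] // _ h; apply/models_atom => //.
  apply: max_team_pairs => //; first by move=> p; rewrite mem_cat => ->.
  by move=> p; rewrite mem_cat => /orP[/csup|/sp].
elim: phi acc => [||x|x|n xs ys|phi1 ih1 phi2 ih2|] acc // df sV racc;
  do ?[apply: main racc => // p; rewrite inE => /eqP -> /=].
- by [].
- by split=> //; apply/sup/sV; rewrite inE.
- by split=> //; apply/sup/sV; rewrite inE.
- apply: main racc => // p /mem_zip [/mapP[x xin ->] /mapP[y yin ->]].
  by split; apply/sup/sV; rewrite /= mem_cat ?xin ?yin ?orbT.
- move: df racc => /= /andP[d1 d2] racc; split; last first.
    by apply: ih2 racc => // x xin; apply: sV; rewrite /= mem_cat xin orbT.
  apply: (ih1 acc) => //; last exact: respects_acc racc.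
  by move=> x xin; apply: sV; rewrite /= mem_cat xin.
Qed.

End ToTeam.

Theorem satisfiable_consistent phi : disj_free phi ->
  satisfiable phi <-> consistent (clauses phi [::]) (inr true) (inr false).
Proof.
move=> df; split=> [[V [T [sV T0 m]]]|[f rf ntf]].
  exists (column T); first by apply: respects_column.
  by move: T0 => /set0Pn [t tT] /columnP/(_ _ tT).
exists [fset x in vars phi]%fset, (max_team f _); split.
- by move=> x xin; rewrite inE.
- exact: max_team_neq0.
- by apply: max_team_models rf => // x xin; rewrite inE.
Qed.

(** * Generating the clauses of an atom *)

Notation word := (seq token).

Notation on i p := (fun o : tops => p (nth None o i)).

Definition filled (o : option token) : bool := o != None.

(** The two constants count as digits because a term is stored as a word that is either a binary
    numeral or the letter of a constant. *)
Definition digit (o : option token) : bool :=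
  if o is Some (Tk0 | Tk1 | TkTop | TkBot) then true else false.

Definition word_le (L : nat) (w : word) : bool :=
  all (fun a => digit (Some a)) w && (size w <= L).

Definition Mov (i j : nat) : cmd := Copy i j ;; Pop i.

(** The last letter is pushed first, so that s can be read from the top. *)
Definition Pushes (i : nat) (s : seq token) : cmd :=
  foldr (fun a c => c ;; Push i a) Skip s.

Arguments Pushes : simpl never.

Lemma exec_conv c S n S1 m S' :
  exec c S n S1 -> S1 = S' -> n <= m -> exec c S m S'.
Proof. by move=> e <-; apply: exec_le. Qed.

Lemma all_filled (w : word) : all (fun a => filled (Some a)) w.
Proof. by elim: w. Qed.

Lemma upd_ext (S1 S2 : stacks) : size S1 = size S2 ->
  (forall i, nth [::] S1 i = nth [::] S2 i) -> S1 = S2.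
Proof. by move=> es en; apply: (@eq_from_nth _ [::]) => // i _. Qed.

Lemma size_upd (S : stacks) i s : i < size S -> size (upd S i s) = size S.
Proof. by move=> lti; rewrite size_set_nth; apply/maxn_idPr. Qed.

Lemma nth_upd (S : stacks) i s k :
  nth [::] (upd S i s) k = if k == i then s else nth [::] S k.
Proof. by rewrite nth_set_nth. Qed.

Lemma exec_mov S i j a s : i < size S -> j < size S -> i != j ->
  nth [::] S i = a :: s ->
  exec (Mov i j) S 3 (upd (upd S i s) j (a :: nth [::] S j)).
Proof.
move=> lti ltj ij e; apply: (@exec_conv _ _ _ (upd (upd S j (a :: nth [::] S j)) i s)).
- apply: (exec_seq (exec_copy e ltj)).
  have -> : s = behead (nth [::] (upd S j (a :: nth [::] S j)) i).
    by rewrite nth_upd (negPf ij) e.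
  by apply: exec_pop; rewrite size_upd.
- by rewrite set_set_nth (eq_sym j) (negPf ij).
- by [].
Qed.

(** * Basic loops over a stack *)

Section Loops.

Variables (p : option token -> bool) (i : nat).

(** The hypotheses make w the longest prefix whose letters pass the test. Each letter costs one test
    and a move of three steps. *)
Lemma exec_move j S w r : i < size S -> j < size S -> i != j ->
  nth [::] S i = w ++ r -> all (fun a => p (Some a)) w -> ~~ p (ohead r) ->
  exec (While (on i p) (Mov i j)) S (4 * size w).+1
       (upd (upd S i r) j (rev w ++ nth [::] S j)).
Proof.
elim: w S => [|a w ih] S lti ltj ij e /= aw pr.
  apply: (@exec_conv _ _ 1 S) => //.
    by apply: exec_while_end; rewrite (nth_map [::]) // e.
  apply: upd_ext; first by rewrite !size_upd.
  by move=> k; rewrite !nth_upd; case: eqP => [->//|_]; case: eqP => [->|].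
case/andP: aw => pa aw; apply: exec_conv.
- apply: exec_while_loop; first by rewrite /= (nth_map [::]) // e.
    exact: (exec_mov lti ltj ij e).
  apply: (ih (upd (upd S i (w ++ r)) j (a :: nth [::] S j))) => //;
    rewrite ?size_upd ?size_upd //.
  by rewrite nth_upd (negPf ij) nth_upd eqxx.
- apply: upd_ext; first by rewrite !size_upd ?size_upd ?size_upd.
  move=> k; rewrite !nth_upd eqxx rev_cons cat_rcons.
  by case: (eqVneq k j) => // kj; case: (eqVneq k i).
- by lia.
Qed.

Lemma exec_copy_move j k S w r : i < size S -> j < size S -> k < size S ->
  i != j -> i != k -> j != k ->
  nth [::] S i = w ++ r -> all (fun a => p (Some a)) w -> ~~ p (ohead r) ->
  exec (While (on i p) (Copy i k ;; Mov i j)) S (6 * size w).+1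
    (upd (upd (upd S i r) j (rev w ++ nth [::] S j)) k (rev w ++ nth [::] S k)).
Proof.
elim: w S => [|a w ih] S lti ltj ltk ij ik jk e /= aw pr.
  apply: (@exec_conv _ _ 1 S) => //.
    by apply: exec_while_end; rewrite (nth_map [::]) // e.
  apply: upd_ext; first by rewrite !size_upd ?size_upd.
  move=> l; rewrite !nth_upd.
  by case: eqP => [->//|_]; case: eqP => [->|_] //; case: eqP => [->|].
case/andP: aw => pa aw; apply: exec_conv.
- apply: exec_while_loop; first by rewrite /= (nth_map [::]) // e.
    apply: exec_seq; first exact: (exec_copy e ltk).
    apply: (@exec_mov _ i j a (w ++ r)); rewrite ?size_upd //.
    by rewrite nth_upd (negPf ik).
  apply: (ih (upd (upd (upd S k (a :: nth [::] S k)) i (w ++ r)) j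
                (a :: nth [::] (upd S k (a :: nth [::] S k)) j))) => //;
    rewrite ?size_upd ?size_upd ?size_upd //.
  by rewrite nth_upd (negPf ij) nth_upd eqxx.
- apply: upd_ext; first by rewrite !size_upd ?size_upd ?size_upd ?size_upd.
  move=> l; rewrite !nth_upd eqxx (negPf jk) (eq_sym k i) (eq_sym k j).
  rewrite (negPf jk) (negPf ik) eqxx !rev_cons !cat_rcons.
  by case: (eqVneq l k) => // lk; case: (eqVneq l j) => // lj; case: (eqVneq l i).
- by lia.
Qed.

Lemma exec_drop S w r : i < size S -> nth [::] S i = w ++ r ->
  all (fun a => p (Some a)) w -> ~~ p (ohead r) ->
  exec (While (on i p) (Pop i)) S (2 * size w).+1 (upd S i r).
Proof.
elim: w S => [|a w ih] S lti e /= aw pr.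
  apply: (@exec_conv _ _ 1 S) => //.
    by apply: exec_while_end; rewrite (nth_map [::]) // e.
  apply: upd_ext; first by rewrite size_upd.
  by move=> k; rewrite nth_upd; case: eqP => [->|].
case/andP: aw => pa aw; apply: exec_conv.
- apply: exec_while_loop; first by rewrite /= (nth_map [::]) // e.
    exact: (exec_pop lti).
  apply: ih; rewrite ?size_upd // nth_upd eqxx e //.
- by rewrite set_set_nth eqxx.
- by lia.
Qed.

Lemma exec_pushes S s : i < size S ->
  exec (Pushes i s) S (2 * size s).+1 (upd S i (s ++ nth [::] S i)).
Proof.
move=> lti; elim: s => [|a s ih] /=.
  apply: (exec_conv (exec_skip S)) => //.
  apply: upd_ext; first by rewrite size_upd.
  by move=> k; rewrite nth_upd; case: eqP => [->|].
apply: exec_conv.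
- apply: exec_seq; first exact: ih.
  by apply: exec_push; rewrite size_upd.
- by rewrite set_set_nth eqxx nth_upd eqxx.
- by lia.
Qed.

End Loops.

(* Stack 0 holds the input, later the clauses already examined; stack 8 holds the
   clauses still to be examined; the others are scratch, except that the solver
   leaves a mark on stack 4 to reject. Moving a stack onto another one reverses
   it, so words appear both as X w and, reversed, as w' X. *)
Definition enc (ws : seq word) : seq token := flatten [seq TkX :: w | w <- ws].

Lemma enc_cat ws1 ws2 : enc (ws1 ++ ws2) = enc ws1 ++ enc ws2.
Proof. by rewrite /enc map_cat flatten_cat. Qed.

Lemma rev_enc_rcons ws w :
  rev (enc (rcons ws w)) = rev w ++ TkX :: rev (enc ws).
Proof.
have -> : enc (rcons ws w) = enc ws ++ TkX :: w.
  by rewrite -cats1 enc_cat /enc /= cats0.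
by rewrite rev_cat rev_cons cat_rcons.
Qed.

Lemma digit_enc ws : digit (ohead (enc ws)) = false.
Proof. by case: ws. Qed.

Definition clause_words (k : clause word) : seq word :=
  [:: k.1.1; k.1.2; k.2.1; k.2.2].

Definition enc_clauses (K : seq (clause word)) : seq token :=
  enc (flatten (map clause_words K)).

Arguments enc_clauses : simpl never.

(** The second component comes first, so that the reversed stack delivers the first one first: it
    belongs to the conclusion of a clause, which is pushed before the premise. *)
Definition enc_pairs (ps : seq (word * word)) : seq token :=
  enc (flatten [seq [:: p.2; p.1] | p <- ps]).

Lemma enc_clauses_cat K1 K2 :
  enc_clauses (K1 ++ K2) = enc_clauses K1 ++ enc_clauses K2.
Proof. by rewrite /enc_clauses map_cat flatten_cat enc_cat. Qed.

Lemma enc_pairs_cat ps1 ps2 :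
  enc_pairs (ps1 ++ ps2) = enc_pairs ps1 ++ enc_pairs ps2.
Proof. by rewrite /enc_pairs map_cat flatten_cat enc_cat. Qed.

Lemma rev_enc_pairs_rcons ps p : rev (enc_pairs (rcons ps p)) =
  rev p.1 ++ TkX :: rev p.2 ++ TkX :: rev (enc_pairs ps).
Proof.
rewrite -cats1 enc_pairs_cat rev_cat /enc_pairs /= /enc /= cats0.
by rewrite rev_cons rev_cat rev_cons cat_rcons cat_rcons -!catA.
Qed.

Ltac loop_side := rewrite /= ?cats0 ?digit_enc //;
  try solve [exact: all_filled | by rewrite all_rev].

Tactic Notation "run" open_constr(lem) :=
  apply: exec_seq; [by eapply lem; loop_side | rewrite /= ?revK ?cats0].

(* Pushes the word stored in reverse on stack u on the output stack 8; stack 7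
   is scratch. *)
Definition Emit (u : nat) : cmd :=
  While (on u filled) (Copy u 8 ;; Mov u 7) ;; Push 8 TkX ;;
  While (on 7 filled) (Mov 7 u).

Lemma exec_emit u s0 s1 s2 s3 s4 s5 s6 t w L : word_le L w ->
  (u == 5) && (s5 == rev w) || (u == 6) && (s6 == rev w) ->
  exec (Emit u) [:: s0; s1; s2; s3; s4; s5; s6; [::]; t] (10 * L + 4)
    [:: s0; s1; s2; s3; s4; s5; s6; [::]; TkX :: w ++ t].
Proof.
move=> /andP[_ sw] /orP[]/andP[/eqP -> /eqP ->]; apply: exec_conv.
- run (@exec_copy_move filled 5 7 8 _ (rev w) [::]).
  run exec_push.
  by apply: (@exec_move filled 7 5 _ w [::]); loop_side.
- by rewrite /= cats0.
- by rewrite size_rev; lia.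
- run (@exec_copy_move filled 6 7 8 _ (rev w) [::]).
  run exec_push.
  by apply: (@exec_move filled 7 6 _ w [::]); loop_side.
- by rewrite /= cats0.
- by rewrite size_rev; lia.
Qed.

(** The next word of stack 4 goes to the output stack and also back to stack 3, so that a pass over
    stack 4 rebuilds the list of remaining pairs. *)
Definition Transfer : cmd :=
  While (on 4 digit) (Copy 4 8 ;; Mov 4 3) ;; Push 8 TkX ;; Mov 4 3.

Lemma exec_transfer s0 s1 s2 p q s5 s6 s7 t w L : word_le L w ->
  exec Transfer [:: s0; s1; s2; p; rev w ++ TkX :: q; s5; s6; s7; t] (6 * L + 6)
    [:: s0; s1; s2; TkX :: w ++ p; q; s5; s6; s7; TkX :: w ++ t].
Proof.
move=> /andP[dw sw]; apply: exec_conv.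
- run (@exec_copy_move digit 4 3 8 _ (rev w) (TkX :: q)).
  run exec_push.
  by apply: (@exec_mov _ 4 3 TkX q).
- by rewrite /=.
- by rewrite size_rev; lia.
Qed.

(** With pivot (x, y) and current pair q, the pushes q.1, x, q.2, y leave y, q.2, x, q.1 from the
    top, which is the clause y = q.2 implies x = q.1. *)
Definition GenInner : cmd :=
  While (on 4 filled) (Transfer ;; Emit 5 ;; Transfer ;; Emit 6).

Definition pair_le L (p : word * word) := word_le L p.1 && word_le L p.2.

(** Stack 4 holds the pairs reversed, whence the induction from the end; the clause of the last pair
    is pushed first and lies deepest, as in the list. *)
Lemma exec_gen_inner s0 s1 s2 p x y t ps L :
  word_le L x -> word_le L y -> all (pair_le L) ps ->
  exec GenInner
    [:: s0; s1; s2; p; rev (enc_pairs ps); rev x; rev y; [::]; t]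
    (size ps * (32 * L + 21)).+1
    [:: s0; s1; s2; enc_pairs ps ++ p; [::]; rev x; rev y; [::];
        enc_clauses [seq clause_of (x, y) q | q <- ps] ++ t].
Proof.
move=> wx wy; elim/last_ind: ps p t => [|ps q ih] p t /=.
  by move=> _; apply: exec_while_end.
rewrite all_rcons => /andP[/andP[w1 w2] wps].
rewrite rev_enc_pairs_rcons; apply: exec_conv.
- apply: exec_while_loop; first by rewrite /=; case: (rev _).
    apply: exec_seq; first apply: exec_transfer w1.
    apply: exec_seq; first by apply: (@exec_emit _ _ _ _ _ _ _ _ _ x L); rewrite /= ?eqxx.
    apply: exec_seq; first apply: exec_transfer w2.
    by apply: (@exec_emit _ _ _ _ _ _ _ _ _ y L); rewrite /= ?eqxx.
  exact: ih.
- rewrite -cats1 map_cat enc_pairs_cat enc_clauses_cat /enc_clauses /enc_pairs.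
  by rewrite /= /enc /= !cats0; do !rewrite -!catA /=.
- by rewrite size_rcons; lia.
Qed.

(** As in [gen], each pair becomes the pivot once. It is kept reversed on stacks 5 and 6 while the
    inner loop visits the later pairs and returns them to stack 3. *)
Definition Gen : cmd :=
  While (on 3 filled) (
    Pop 3 ;; While (on 3 digit) (Mov 3 6) ;;
    Pop 3 ;; While (on 3 digit) (Mov 3 5) ;;
    While (on 3 filled) (Mov 3 4) ;; GenInner ;;
    While (on 5 filled) (Pop 5) ;; While (on 6 filled) (Pop 6)).

Lemma size_enc_pairs L ps : all (pair_le L) ps ->
  size (enc_pairs ps) <= size ps * (2 * L + 2).
Proof.
elim: ps => //= -[x y] ps ih /andP[/andP[/andP[_ /= lx] /andP[_ /= ly]] /ih].
rewrite /enc_pairs /enc /= size_cat /= size_cat; lia.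
Qed.

Lemma exec_gen s0 s1 s2 ps acc L : all (pair_le L) ps ->
  exec Gen [:: s0; s1; s2; enc_pairs ps; [::]; [::]; [::]; [::]; enc_clauses acc]
    (size ps * size ps * (40 * L + 40)).+1
    [:: s0; s1; s2; [::]; [::]; [::]; [::]; [::]; enc_clauses (gen ps acc)].
Proof.
elim: ps acc => [|[x y] ps ih] acc /=; first by move=> _; apply: exec_while_end.
case/andP=> /andP[/= wx wy] wps.
have -> : enc_pairs ((x, y) :: ps) = TkX :: y ++ TkX :: x ++ enc_pairs ps by [].
have/andP[dx sx] := wx; have/andP[dy sy] := wy.
apply: exec_conv.
- apply: exec_while_loop; first by [].
    run exec_pop.
    run (@exec_move digit 3 6 _ y (TkX :: x ++ enc_pairs ps)).
    run exec_pop.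
    run (@exec_move digit 3 5 _ x (enc_pairs ps)).
    run (@exec_move filled 3 4 _ (enc_pairs ps) [::]).
    apply: exec_seq; first exact: (exec_gen_inner _ _ _ _ _ wx wy wps).
    run (@exec_drop filled 5 _ (rev x) [::]).
    by apply: (@exec_drop filled 6 _ (rev y) [::]); loop_side.
  rewrite /= -enc_clauses_cat; exact: ih.
- by [].
- have := size_enc_pairs wps; rewrite !size_rev.
  by nia.
Qed.

Definition Zip : cmd :=
  While (on 1 filled) (
    While (on 1 digit) (Mov 1 3) ;; Mov 1 3 ;;
    While (on 2 digit) (Mov 2 3) ;; Mov 2 3).

Lemma exec_zip s0 p s4 s5 s6 s7 s8 ps L : all (pair_le L) ps ->
  exec Zip [:: s0; rev (enc (unzip1 ps)); rev (enc (unzip2 ps)); p;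
               s4; s5; s6; s7; s8] (size ps * (8 * L + 9)).+1
    [:: s0; [::]; [::]; enc_pairs ps ++ p; s4; s5; s6; s7; s8].
Proof.
elim/last_ind: ps p => [|ps [x y] ih] p; first by move=> _; apply: exec_while_end.
rewrite all_rcons /unzip1 /unzip2 !map_rcons => /andP[/andP[/= wx wy] wps].
have/andP[dx sx] := wx; have/andP[dy sy] := wy.
rewrite !rev_enc_rcons; apply: exec_conv.
- apply: exec_while_loop; first by rewrite /=; case: (rev _).
    run (@exec_move digit 1 3 _ (rev x) (TkX :: rev (enc (unzip1 ps)))).
    run (@exec_mov _ 1 3 TkX (rev (enc (unzip1 ps)))).
    run (@exec_move digit 2 3 _ (rev y) (TkX :: rev (enc (unzip2 ps)))).
    by apply: (@exec_mov _ 2 3 TkX (rev (enc (unzip2 ps)))).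
  exact: ih.
- rewrite -cats1 enc_pairs_cat /enc_pairs /= /enc /= cats0.
  by do !rewrite -!catA /=.
- by rewrite size_rcons !size_rev; lia.
Qed.

Definition const_word (b : bool) : word := [:: if b then TkTop else TkBot].

(** This ends an atom, with left words on stack 1 and right words on stack 2. An empty stack 2
    stands for the word of true, which covers top, bottom and positive literals; an empty stack 1
    means that no pair is pending. *)
Definition Flush : cmd :=
  If (on 1 filled) (
    If (on 2 filled) Skip (Pushes 2 (rev (enc [:: const_word true]))) ;;
    Zip ;; Pushes 3 (enc_pairs (const_pairs const_word)) ;; Gen) Skip.

Lemma exec_flush s0 b ps acc L : 0 < L -> 0 < size ps -> all (pair_le L) ps ->
  b = rev (enc (unzip2 ps)) \/
    b = [::] /\ unzip2 ps = [:: const_word true] ->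
  exec Flush [:: s0; rev (enc (unzip1 ps)); b; [::]; [::]; [::]; [::]; [::];
                 enc_clauses acc]
    ((size ps).+2 * (size ps).+2 * (50 * L + 60))
    [:: s0; [::]; [::]; [::]; [::]; [::]; [::]; [::];
        enc_clauses (gen (const_pairs const_word ++ ps) acc)].
Proof.
move=> L0 ps0 wps eb.
have fil qs : 0 < size qs -> filled (ohead (rev (enc qs))).
  by case/lastP: qs => [//|qs w _]; rewrite rev_enc_rcons; case: (rev _).
have wcps : all (pair_le L) (const_pairs const_word ++ ps).
  by rewrite all_cat wps andbT /= /pair_le /word_le /= L0.
apply: exec_conv.
- apply: exec_if; rewrite /= fil ?size_map //.
  apply: exec_seq.
    apply: (@exec_conv _ _ 6 [:: s0; rev (enc (unzip1 ps)); rev (enc (unzip2 ps));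
      [::]; [::]; [::]; [::]; [::]; enc_clauses acc]); last by [].
      apply: exec_if => /=; case: eb => [->|[-> ->]].
        by rewrite fil ?size_map //; apply: exec_le; first exact: exec_skip.
      by apply: (exec_conv (@exec_pushes 2 _ (rev (enc [:: const_word true])) _)).
    by [].
  apply: exec_seq; first exact: exec_zip wps.
  run exec_pushes.
  exact: (exec_gen s0 [::] [::] acc wcps).
- by [].
- rewrite size_cat /=; nia.
Qed.

(** * Solving the clauses *)

Definition Read (r : nat) : cmd :=
  Push 0 TkX ;; Pop 8 ;; While (on 8 digit) (Copy 8 0 ;; Mov 8 r).

Lemma exec_read r S w t L : word_le L w -> ~~ digit (ohead t) ->
  r < size S -> 8 < size S -> r != 0 -> r != 8 ->
  nth [::] S r = [::] -> nth [::] S 8 = TkX :: w ++ t ->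
  exec (Read r) S (6 * L + 4)
    (upd (upd (upd S 0 (rev w ++ TkX :: nth [::] S 0)) 8 t) r (rev w)).
Proof.
move=> /andP[dw sw] dt ltr lt8 r0 r8 er e8.
have lt0 : 0 < size S by apply: leq_trans lt8.
apply: exec_conv.
- apply: exec_seq; first exact: exec_push.
  apply: exec_seq; first by apply: exec_pop; rewrite size_upd.
  apply: (@exec_copy_move digit 8 r 0 _ w t); rewrite ?size_upd ?size_upd //.
    by rewrite eq_sym.
  by rewrite !nth_upd eqxx /= e8.
- apply: upd_ext; first by rewrite !size_upd ?size_upd ?size_upd ?size_upd.
  move=> k; rewrite !nth_upd /= (negPf r0) (negPf r8) er cats0.
  case: (eqVneq k 0) => [->|k0]; first by rewrite eq_sym (negPf r0).
  by case: (eqVneq k r) => // kr; case: (eqVneq k 8).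
- by lia.
Qed.

(** The last condition is the exit condition of the comparison loops below. *)
Lemma common_prefix (x y : word) : exists m x' y',
  [/\ x = m ++ x', y = m ++ y' & (x' == [::]) || (ohead x' != ohead y')].
Proof.
elim: x y => [|a x ih] y; first by exists [::], [::], y.
case: y => [|b y]; first by exists [::], (a :: x), [::].
have [<-|ab] := eqVneq a b.
  have [m [x' [y' [-> -> h]]]] := ih y; by exists (a :: m), x', y'.
by exists [::], (a :: x), (b :: y).
Qed.

Definition Match : cmd :=
  While (fun o => filled (nth None o 1) && (nth None o 1 == nth None o 2))
    (Pop 1 ;; Pop 2).

Lemma exec_match s0 s3 s4 s5 s6 s7 s8 (m x y : word) :
  (x == [::]) || (ohead x != ohead y) ->
  exec Match [:: s0; m ++ x; m ++ y; s3; s4; s5; s6; s7; s8] (3 * size m).+1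
    [:: s0; x; y; s3; s4; s5; s6; s7; s8].
Proof.
move=> h; elim: m => [|a m ih] /=.
  apply: exec_while_end; rewrite /=.
  by case: x h => [|b x] //= h; rewrite (negPf h).
apply: exec_conv.
- apply: exec_while_loop; first by rewrite /= eqxx.
    run exec_pop; by apply: exec_pop.
  exact: ih.
- by [].
- by lia.
Qed.

(** The word on stack 0 is compared with c on stack 5, both reversed; the common part goes to stack
    8 and, for restoring c, to stack 3. If both words are used up, the partial copy on stack 8 is
    erased and d is emitted from stack 6; otherwise the copy is completed. *)
Definition SubstTerm : cmd :=
  While (fun o => digit (nth None o 0) && (nth None o 0 == nth None o 5))
    (Copy 0 8 ;; Mov 5 3 ;; Pop 0) ;;
  If (fun o => ~~ digit (nth None o 0) && ~~ filled (nth None o 5))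
     (While (on 8 digit) (Pop 8) ;; Emit 6)
     (While (on 0 digit) (Mov 0 8) ;; Push 8 TkX) ;;
  Pop 0 ;; While (on 3 filled) (Mov 3 5).

Lemma exec_subst_match s1 s2 p s4 s6 s7 t r (m x y : word) :
  all (fun a => digit (Some a)) m -> (x == [::]) || (ohead x != ohead y) ->
  exec (While (fun o => digit (nth None o 0) && (nth None o 0 == nth None o 5))
    (Copy 0 8 ;; Mov 5 3 ;; Pop 0))
    [:: m ++ x ++ TkX :: r; s1; s2; p; s4; m ++ y; s6; s7; t] (7 * size m).+1
    [:: x ++ TkX :: r; s1; s2; rev m ++ p; s4; y; s6; s7; rev m ++ t].
Proof.
move=> dm h; elim: m p t dm => [|a m ih] p t /=.
  move=> _; apply: exec_while_end; rewrite /=.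
  by case: x h => [|b x] //= h; rewrite (negPf h) andbF.
case/andP=> da dm; apply: exec_conv.
- apply: exec_while_loop; first by rewrite /= eqxx andbT.
    apply: exec_seq; first exact: (exec_copy (i := 0) (j := 8)).
    apply: exec_seq; first by apply: (@exec_mov _ 5 3 a (m ++ y)).
    by apply: exec_pop.
  exact: ih.
- by rewrite /= !rev_cons !cat_rcons.
- by lia.
Qed.

Lemma exec_subst_term s1 s2 s4 w c d t r L :
  word_le L w -> word_le L c -> word_le L d -> ~~ digit (ohead t) ->
  exec SubstTerm
    [:: rev w ++ TkX :: r; s1; s2; [::]; s4; rev c; rev d; [::]; t] (30 * L + 20)
    [:: r; s1; s2; [::]; s4; rev c; rev d; [::]; TkX :: subst c d w ++ t].
Proof.
move=> ww wc wd dt.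
have [m [x [y [ew ec h]]]] := common_prefix (rev w) (rev c).
have/andP[dw sw] := ww; have/andP[dc sc] := wc.
have/andP[dm dx] : all (fun a => digit (Some a)) m && all (fun a => digit (Some a)) x.
  by rewrite -all_cat -ew all_rev.
have smx : size m + size x <= L by rewrite -size_cat -ew size_rev.
rewrite ew ec -catA; apply: exec_conv.
- apply: exec_seq; first exact: exec_subst_match.
  rewrite cats0.
  apply: (@exec_seq _ _ _ [:: TkX :: r; s1; s2; rev m; s4; y; rev d; [::];
     TkX :: subst c d w ++ t] _ (18 * L + 10)).
    (* The maximum covers both branches, and the successor pays for the test. *)
    apply: (@exec_le _ _ (maxn (2 * L + 1 + (10 * L + 4)) (4 * L + 3)).+1); last by clear; lia.
    apply: exec_if => /=.
    case: ifP => hc.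
      have [x0 y0] : x = [::] /\ y = [::].
        by move: hc dx; case: (x) (y) => [|a x0] [|b y0] //= hc /andP[da _]; move: hc; rewrite da.
      have wc_eq : w = c by apply: (can_inj revK); rewrite ew ec x0 y0.
      rewrite x0 y0 /subst wc_eq eqxx; apply: exec_conv.
      - run (@exec_drop digit 8 _ (rev m) t).
        by apply: (@exec_emit _ _ _ _ _ _ _ _ _ d L); rewrite /= ?eqxx.
      - by [].
      - by rewrite size_rev; clear -smx; lia.
    have nwc : w != c.
      apply/eqP => e; move: ew ec h hc; rewrite e => -> /eqP.
      rewrite eqseq_cat // eqxx /= => /eqP ->; rewrite eqxx orbF.
      by case: (y).
    rewrite /subst (negPf nwc); apply: exec_conv.
    - run (@exec_move digit 0 8 _ x (TkX :: r)).
      by apply: exec_push.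
    - by rewrite /= catA -rev_cat -ew revK.
    - by clear -smx; lia.
  run exec_pop.
  by apply: (@exec_move filled 3 5 _ (rev m) [::]); loop_side.
- by rewrite /= revK.
- by rewrite size_rev; clear -smx; lia.
Qed.

Definition Subst : cmd := While (on 0 filled) SubstTerm.

Lemma exec_subst s1 s2 s4 c d t ws L :
  word_le L c -> word_le L d -> all (word_le L) ws -> ~~ digit (ohead t) ->
  exec Subst
    [:: rev (enc ws); s1; s2; [::]; s4; rev c; rev d; [::]; t]
    (size ws * (30 * L + 21)).+1
    [:: [::]; s1; s2; [::]; s4; rev c; rev d; [::]; enc (map (subst c d) ws) ++ t].
Proof.
move=> wc wd; elim/last_ind: ws t => [|ws w ih] t.
  by move=> _ _; apply: exec_while_end.
rewrite all_rcons rev_enc_rcons => /andP[ww wws] dt; apply: exec_conv.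
- apply: exec_while_loop; first by rewrite /=; case: (rev _).
    exact: exec_subst_term ww wc wd dt.
  exact: ih.
- by rewrite map_rcons -cats1 enc_cat /enc /= cats0 -catA.
- by rewrite size_rcons; lia.
Qed.

Definition DropTerm : cmd := While (on 0 digit) (Pop 0) ;; Pop 0.

Lemma exec_drop_term s0 S w L : word_le L w ->
  exec DropTerm ((rev w ++ TkX :: s0) :: S) (2 * L + 2) (s0 :: S).
Proof.
move=> /andP[dw sw]; apply: exec_conv.
- run (@exec_drop digit 0 _ (rev w) (TkX :: s0)).
  exact: exec_pop.
- by [].
- by rewrite size_rev; lia.
Qed.

Definition Clear (i : nat) : cmd := While (on i filled) (Pop i).

Lemma exec_clear i S L : i < size S -> size (nth [::] S i) <= L ->
  exec (Clear i) S (2 * L + 1) (upd S i [::]).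
Proof.
move=> lti sz; apply: exec_conv.
- by apply: (@exec_drop filled i S (nth [::] S i) [::]); loop_side.
- by [].
- by lia.
Qed.

Definition clause_le L (k : clause word) := all (word_le L) (clause_words k).

Lemma enc_clauses_cons k K : enc_clauses (k :: K) =
  TkX :: k.1.1 ++ TkX :: k.1.2 ++ TkX :: k.2.1 ++ TkX :: k.2.2 ++ enc_clauses K.
Proof. by []. Qed.

Lemma rev_enc_clauses_rcons K k : rev (enc_clauses (rcons K k)) =
  rev k.2.2 ++ TkX :: rev k.2.1 ++ TkX :: rev k.1.2 ++ TkX :: rev k.1.1 ++
  TkX :: rev (enc_clauses K).
Proof.
rewrite /enc_clauses map_rcons flatten_rcons /clause_words.
by rewrite -!cat_rcons cats0 !rev_enc_rcons !cat_rcons.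
Qed.

Lemma size_enc_clauses L K : all (clause_le L) K ->
  size (enc_clauses K) <= size K * (4 * L + 4).
Proof.
elim: K => // k K ih; rewrite enc_clauses_cons.
case/andP=> /and5P[/andP[_ l1] /andP[_ l2] /andP[_ l3] /andP[_ l4] _] /ih.
by rewrite /= size_cat /= size_cat /= size_cat /= size_cat; lia.
Qed.

Lemma all_clause_words L K :
  all (clause_le L) K = all (word_le L) (flatten (map clause_words K)).
Proof. by elim: K => //= k K ->; rewrite /clause_le /= !andbA andbT. Qed.

Lemma enc_clauses_map f K :
  enc (map f (flatten (map clause_words K))) = enc_clauses (map (map_clause f) K).
Proof.
by rewrite /enc_clauses map_flatten -!map_comp.
Qed.

Lemma subst_le L c d w : word_le L d -> word_le L w -> word_le L (subst c d w).
Proof. by rewrite /subst; case: eqP. Qed.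

Lemma clause_le_subst L c d k : word_le L d -> clause_le L k ->
  clause_le L (map_clause (subst c d) k).
Proof.
by move=> wd /and5P[w1 w2 w3 w4 _]; rewrite /clause_le /= !subst_le.
Qed.

Definition solve_cost (M L : nat) : nat := (M + 1) * (200 * L + 200).

Notation solver_state D q T :=
  [:: D; [::]; [::]; [::]; q; [::]; [::]; [::]; T].

(** One clause is saved on stack 0 and spread over stacks 1, 2, 5 and 6. If its premise is an
    identity, it is removed from stack 0 and its conclusion is substituted in all other clauses,
    which return to stack 8 for a new examination. If stack 8 is empty, however, the clause is the
    goal, and a mark is left on stack 4. *)
Definition SolveBody : cmd :=
    Read 1 ;; Read 2 ;; Read 5 ;; Read 6 ;; Match ;;
    If (fun o => ~~ filled (nth None o 1) && ~~ filled (nth None o 2))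
       (If (on 8 filled)
           (DropTerm ;; DropTerm ;; DropTerm ;; DropTerm ;;
            While (on 8 filled) (Mov 8 0) ;; Subst)
           (Push 4 TkX))
       Skip ;;
    Clear 1 ;; Clear 2 ;; Clear 5 ;; Clear 6.

Definition Solve : cmd := While (on 8 filled) SolveBody.

Lemma exec_solve_body L M K1 k K2 : clause_le L k ->
  all (clause_le L) K1 -> all (clause_le L) K2 -> size K1 + size K2 <= M ->
  exec SolveBody (solver_state (rev (enc_clauses K1)) [::] (enc_clauses (k :: K2)))
    (solve_cost M L)
    (if k.1.1 == k.1.2 then
       if K2 is [::] then solver_state (rev (enc_clauses (rcons K1 k))) [:: TkX] [::]
       else solver_state [::] [::]
              (enc_clauses (map (map_clause (subst k.2.1 k.2.2)) (K1 ++ K2)))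
     else solver_state (rev (enc_clauses (rcons K1 k))) [::] (enc_clauses K2)).
Proof.
move=> /and5P[wa wb wc wd _] wK1 wK2 sK.
case: k wa wb wc wd => -[a b] [c d] /= wa wb wc wd.
have [m [x [y [ea eb h]]]] := common_prefix (rev a) (rev b).
have/andP[_ sa] := wa; have/andP[_ sb] := wb.
have/andP[_ sc] := wc; have/andP[_ sd] := wd.
have smx : size m + size x <= L by rewrite -size_cat -ea size_rev.
have smy : size m + size y <= L by rewrite -size_cat -eb size_rev.
(* The comparison empties both stacks exactly when the premise is an identity. *)
have e_xy : (a == b) = (x == [::]) && (y == [::]).
  apply/eqP/andP => [e|[/eqP x0 /eqP y0]].
    move: ea eb h; rewrite e => -> /eqP; rewrite eqseq_cat // eqxx /= => /eqP ->.
    by rewrite eqxx orbF.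
  by apply: (can_inj revK); rewrite ea eb x0 y0.
rewrite /SolveBody enc_clauses_cons; apply: exec_conv.
- apply: exec_seq; first by apply: (exec_read (r := 1) (t := TkX :: _) wa).
  apply: exec_seq; first by apply: (exec_read (r := 2) (t := TkX :: _) wb).
  apply: exec_seq; first by apply: (exec_read (r := 5) (t := TkX :: _) wc).
  apply: exec_seq; first by
    apply: (exec_read (r := 6) (t := enc_clauses K2) wd); rewrite ?digit_enc.
  rewrite /= {2}ea {2}eb.
  apply: exec_seq; first exact: exec_match.
  apply: (@exec_seq _ _ _ (
      if a == b then
       if K2 is [::] then
         [:: rev (enc_clauses (rcons K1 (a, b, (c, d)))); x; y; [::]; [:: TkX];
             rev c; rev d; [::]; [::]]
       else
         [:: [::]; x; y; [::]; [::]; rev c; rev d; [::];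
             enc_clauses (map (map_clause (subst c d)) (K1 ++ K2))]
      else
       [:: rev (enc_clauses (rcons K1 (a, b, (c, d)))); x; y; [::]; [::];
           rev c; rev d; [::]; enc_clauses K2])
      _ ((M + 1) * (136 * L + 136) + 20)).
    apply: (@exec_le _ _ (maxn ((M + 1) * (136 * L + 136) + 10) 3).+1); last by clear; lia.
    apply: exec_if => /=; rewrite /filled.
    have -> : ~~ (ohead x != None) && ~~ (ohead y != None) = (a == b).
      by rewrite e_xy !negbK; case: (x) (y) => [|? ?] [|? ?].
    case: ifP => ab; last first.
      rewrite rev_enc_clauses_rcons; apply: (@exec_le _ _ 1) => //; first exact: exec_skip.
      by rewrite leq_max orbT.
    apply: (@exec_le _ _ (maxn ((M + 1) * (136 * L + 136) + 9) 2).+1); last by clear; lia.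
    apply: exec_if => /=.
    case: K2 wK2 sK => [|k2 K2] wK2 sK.
      rewrite rev_enc_clauses_rcons; apply: (@exec_le _ _ 2); last by rewrite leq_max orbT.
      exact: (@exec_push [:: _; _; _; _; _; _; _; _; _] 4).
    apply: exec_conv.
    + apply: exec_seq; first exact: exec_drop_term wd.
      apply: exec_seq; first exact: exec_drop_term wc.
      apply: exec_seq; first exact: exec_drop_term wb.
      apply: exec_seq; first exact: exec_drop_term wa.
      run (@exec_move filled 8 0 _ (enc_clauses (k2 :: K2)) [::]).
      rewrite -rev_cat -enc_clauses_cat.
      apply: exec_subst wc wd _ _ => //.
      by rewrite -all_clause_words all_cat wK1.
    + by rewrite cats0 enc_clauses_map.
    + have sK2 := size_enc_clauses wK2.
      have -> : size (flatten (map clause_words (K1 ++ k2 :: K2))) =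
          4 * (size K1 + size (k2 :: K2)).
        rewrite -size_cat; elim: (K1 ++ k2 :: K2) => //= k K ih.
        by rewrite ih; clear; lia.
      have le2 : size (k2 :: K2) <= M by apply: leq_trans sK; apply: leq_addl.
      by clear -sK sK2 le2; nia.
  have sx : size x <= L by apply: leq_trans smx; apply: leq_addl.
  have sy : size y <= L by apply: leq_trans smy; apply: leq_addl.
  have sc' : size (rev c) <= L by rewrite size_rev.
  have sd' : size (rev d) <= L by rewrite size_rev.
  apply: exec_seq; first by
    apply: (exec_clear (i := 1) (L := L)); case: ifP => // _; case: (K2).
  apply: exec_seq; first by
    apply: (exec_clear (i := 2) (L := L)); case: ifP => // _; case: (K2).
  apply: exec_seq; first by
    apply: (exec_clear (i := 5) (L := L)); case: ifP => // _; case: (K2).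
  by apply: (exec_clear (i := 6) (L := L)); case: ifP => // _; case: (K2).
- by case: ifP => // _; case: (K2).
- by rewrite /solve_cost; clear -smx; nia.
Qed.

(** K1 has been examined without success, K2 is still to be examined, and g is the goal at the
    bottom. The induction is lexicographic: firing a clause decreases n, otherwise K2 shrinks. Since
    firing sends at most M clauses back to K2, [n * (M + 2) + size K2] bounds the remaining rounds
    before the goal. *)
Lemma exec_solve L M n K1 K2 g : size K1 + size K2 = n -> n <= M ->
  all (clause_le L) (K1 ++ K2) -> clause_le L g ->
  all (fun k => k.1.1 != k.1.2) K1 ->
  exists b S', [/\
    exec Solve (solver_state (rev (enc_clauses K1)) [::] (enc_clauses (rcons K2 g)))
      ((n * (M + 2) + size K2 + 1) * (solve_cost (M + 1) L + 1) + 1) S',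
    nth [::] S' 4 = if b then [::] else [:: TkX]
    & b <-> consistent (K1 ++ K2) g.1.1 g.1.2].
Proof.
elim/ltn_ind: n K1 K2 g => n ihn K1 K2.
elim: K2 K1 => [|k K2 ihk] K1 g en leM; rewrite all_cat => /andP[wK1 wK2] wg nK.
  rewrite cats0; exists (g.1.1 != g.1.2).
  exists (solver_state (rev (enc_clauses (rcons K1 g)))
            (if g.1.1 != g.1.2 then [::] else [:: TkX]) [::]).
  split=> //; last by apply: iff_sym; apply: consistent_end.
  apply: exec_le.
    apply: exec_while_loop; first by [].
      (* Only the goal is left; by [consistent_end] its premise decides the question. *)
      apply: (@exec_solve_body L (M + 1) K1 g [::]) => //.
      by apply: leq_trans (leq_addr 1 M); rewrite en.
    by case: eqP => _; apply: exec_while_end.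
  set C := solve_cost _ _; clearbody C; clear; nia.
case/andP: wK2 => wk wK2.
have wK2g : all (clause_le L) (rcons K2 g) by rewrite all_rcons wg.
have sK2g : size K1 + size (rcons K2 g) <= M + 1.
  by rewrite size_rcons; move: en leM => /=; clear; lia.
have eb := exec_solve_body wk wK1 wK2g sK2g.
have t8 K : on 8 filled (map ohead
    (solver_state (rev (enc_clauses K1)) [::] (enc_clauses (rcons (k :: K2) K)))) by [].
case: (eqVneq k.1.1 k.1.2) eb => [ek|nek] eb.
  case: k wk ek eb en t8 => -[a b] [c d] /= wk ek eb en t8; subst b.
  have [] := ihn n.-1 _ [::] (map (map_clause (subst c d)) (K1 ++ K2))
    (map_clause (subst c d) g).
  - by move: en => /= <-; rewrite addnS.
  - by rewrite /= size_map size_cat; move: en => /= <-; rewrite addnS.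
  - by apply: leq_trans leM; apply: leq_pred.
  - rewrite /= all_map; case/and5P: wk => _ _ _ wd _.
    apply/allP => k kK /=; apply: clause_le_subst => //.
    by move: k kK; apply/allP; rewrite all_cat wK1.
  - by apply: clause_le_subst => //; case/and5P: wk.
  - by [].
  move=> b [S' [ex e4 hb]]; exists b, S'; split=> //; last first.
    by apply: (iff_trans hb); apply: iff_sym; apply: consistent_fire.
  apply: exec_le.
    apply: exec_while_loop; [exact: t8|exact: eb|].
    move: ex; rewrite -map_rcons -cats1 -catA cats1.
    case: (rcons K2 g) (size_rcons K2 g) => // k0 K0 _; exact.
  rewrite size_map size_cat.
  move: en leM; set C := solve_cost _ _; clearbody C; clear => /=; nia.
have [] := ihk (rcons K1 k) g.
- by rewrite size_rcons; move: en => /= <-; rewrite addSnnS.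
- by [].
- by rewrite cat_rcons all_cat wK1 /= wk.
- by [].
- by rewrite all_rcons nek.
move=> b [S' [ex e4 hb]]; exists b, S'; split=> //; last by rewrite -cat_rcons.
apply: exec_le.
  by apply: exec_while_loop; [exact: t8|exact: eb|exact: ex].
rewrite /=; set C := solve_cost _ _; clearbody C; clear; nia.
Qed.

(** * Parsing the formula *)

Lemma gen_map (U V : countType) (f : U -> V) ps acc :
  map (map_clause f) (gen ps acc) =
  gen [seq (f p.1, f p.2) | p <- ps] (map (map_clause f) acc).
Proof.
by elim: ps acc => //= p ps ih acc; rewrite ih map_cat -!map_comp.
Qed.

Lemma gen_cat (W : countType) ps (K1 K2 : seq (clause W)) :
  gen ps (K1 ++ K2) = gen ps K1 ++ K2.
Proof. by elim: ps K1 => //= p ps ih K1; rewrite catA ih. Qed.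

(** This keeps the goal below all clauses generated later. *)
Lemma clauses_cat phi K1 K2 : clauses phi (K1 ++ K2) = clauses phi K1 ++ K2.
Proof.
elim: phi K1 => [||x|x|n xs ys|phi1 ih1 phi2 ih2|phi1 _ phi2 _] K1 //;
  last by rewrite /= ih1 ih2.
by rewrite /clauses; case: (atom_pairs _) => // p ps; apply: gen_cat.
Qed.

Lemma size_gen (W : countType) ps (acc : seq (clause W)) :
  size (gen ps acc) <= size acc + size ps * size ps.
Proof.
elim: ps acc => [|p ps ih] acc /=; first by rewrite addn0.
by apply: leq_trans (ih _) _; rewrite size_cat size_map; nia.
Qed.

Lemma all_gen L ps acc : all (pair_le L) ps -> all (clause_le L) acc ->
  all (clause_le L) (gen ps acc).
Proof.
elim: ps acc => //= p ps ih acc /andP[/andP[p1 p2] wps] wacc.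
apply: ih => //; rewrite all_cat wacc andbT all_map.
apply/allP => q /(allP wps) /andP[q1 q2].
by rewrite /= /clause_le /= p1 p2 q1 q2.
Qed.

(** Labellings are transported along f and its left inverse g; this is the passage from terms to the
    words encoding them. *)
Lemma consistent_map (U V : countType) (f : U -> V) g K u v : cancel f g ->
  consistent (map (map_clause f) K) (f u) (f v) <-> consistent K u v.
Proof.
move=> fK; split=> -[h rh huv].
  by exists (h \o f) => // k kK; apply: (rh (map_clause f k)); apply: map_f.
exists (h \o g); last by rewrite /= !fK.
by move=> _ /mapP [k kK ->]; rewrite /= !fK; apply: rh.
Qed.

(** * Terms as words *)

Definition bit (o : option token) : bool :=
  if o is Some (Tk0 | Tk1) then true else false.

Lemma digits_bits x : all (fun a => bit (Some a)) (digits x).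
Proof.
rewrite /digits; case: (bin_of_nat x) => //.
by elim=> //= p ih; rewrite all_rcons.
Qed.

Definition undigits (w : seq token) : nat :=
  foldl (fun n a => n.*2 + (if a is Tk1 then 1 else 0)) 0 w.

Lemma digitsK : cancel digits undigits.
Proof.
move=> x; rewrite -{2}(bin_of_natK x) /digits.
case: (bin_of_nat x) => //= p; rewrite /undigits.
elim: p => //= p ih; rewrite -cats1 foldl_cat ih /= natTrecE ?addn0 ?addn1 //.
Qed.

Definition word_of (u : term) : word :=
  match u with inl x => digits x | inr b => const_word b end.

Definition term_of (w : word) : term :=
  match w with
  | TkTop :: _ => inr true
  | TkBot :: _ => inr false
  | _ => inl (undigits w)
  end.

(** The constants have letters of their own, so their words differ from all binary numerals. *)
Lemma word_ofK : cancel word_of term_of.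
Proof.
case=> [x|[]] //=; rewrite -{2}(digitsK x).
by case: (digits x) (digits_bits x) => [|[]].
Qed.

Definition var_token (o : option token) : bool :=
  if o is Some (TkX | Tk0 | Tk1) then true else false.

Definition const_token (o : option token) : bool :=
  if o is Some (TkTop | TkBot) then true else false.

Definition neg_token (o : option token) : bool :=
  if o is Some TkNeg then true else false.

Definition inc_token (o : option token) : bool :=
  if o is Some TkInc then true else false.

Definition open_token (o : option token) : bool :=
  if o is Some TkOpen then true else false.

Definition separator (a : token) : bool :=
  if a is (TkAnd | TkClose) then true else false.

(** Nesting need not be tracked: a formula without disjunctions is a list of atoms, so opening
    brackets are skipped and every separator ends an atom. A negation puts false on stack 2 as the
    partner of the variable that follows; an inclusion sign directs the variables after it to stack
    2. *)
Definition ScanBody : cmd :=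
  If (on 0 var_token) (Mov 0 1)
  (If (on 0 const_token) (Push 1 TkX ;; Mov 0 1)
  (If (on 0 neg_token)
     (Pop 0 ;; Pushes 2 (rev (enc [:: const_word false])))
  (If (on 0 inc_token) (Pop 0 ;; While (on 0 var_token) (Mov 0 2))
  (If (on 0 open_token) (Pop 0)
  (Pop 0 ;; Flush))))).

Definition Scan : cmd := While (on 0 filled) ScanBody.

Notation scan_state i a b t :=
  [:: i; a; b; [::]; [::]; [::]; [::]; [::]; t].

Definition flush_cost (M : nat) : nat := (M + 2) * (M + 2) * (50 * M + 60).

(** The lemmas on [Scan] have continuation form: a run on the remaining input is extended at its
    beginning. *)
Lemma exec_scan_step S n m S1 S' : filled (ohead (nth [::] S 0)) ->
  exec ScanBody S n S1 -> exec Scan S1 m S' -> exec Scan S (m + n + 1) S'.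
Proof.
move=> f e1 e2; apply: exec_le.
  apply: (exec_while_loop (n1 := n) (n2 := m)) e2; last exact: e1.
  by case: S f {e1}.
by clear; lia.
Qed.

Lemma exec_scan_vars w r a b t n S' : all (fun c => var_token (Some c)) w ->
  exec Scan (scan_state r (rev w ++ a) b t) n S' ->
  exec Scan (scan_state (w ++ r) a b t) (n + 5 * size w) S'.
Proof.
elim: w a n => [|c w ih] a n /=; first by rewrite muln0 addn0.
case/andP=> vc vw; rewrite rev_cons cat_rcons => /(ih _ _ vw) e.
apply: exec_le; first apply: exec_scan_step e => //.
  apply: exec_if; rewrite /= vc; exact: (@exec_mov _ 0 1 c (w ++ r)).
by clear; lia.
Qed.

Lemma exec_scan_sep s r ps acc b n S' M : separator s ->
  0 < size ps -> size ps <= M -> all (pair_le M) ps ->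
  b = rev (enc (unzip2 ps)) \/
    b = [::] /\ unzip2 ps = [:: const_word true] ->
  exec Scan (scan_state r [::] [::]
    (enc_clauses (gen (const_pairs const_word ++ ps) acc))) n S' ->
  exec Scan (scan_state (s :: r) (rev (enc (unzip1 ps))) b (enc_clauses acc))
    (n + flush_cost M + 7) S'.
Proof.
move=> sep ps0 psM wps eb e.
apply: exec_le; first apply: exec_scan_step e => //.
  do 5 (apply: exec_if; rewrite /= ifN; last by case: (s) sep).
  apply: exec_seq; first exact: exec_pop.
  by apply: (exec_flush r acc _ ps0 wps eb); apply: leq_trans psM.
rewrite /flush_cost; clear -psM; nia.
Qed.

(** Nothing is pending after a closing bracket or after an inclusion between empty tuples. *)
Lemma exec_scan_sep0 s r t n S' M : separator s ->
  exec Scan (scan_state r [::] [::] t) n S' ->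
  exec Scan (scan_state (s :: r) [::] [::] t) (n + flush_cost M + 7) S'.
Proof.
move=> sep e.
apply: exec_le; first apply: exec_scan_step e => //.
  do 5 (apply: exec_if; rewrite /= ifN; last by case: (s) sep).
  apply: exec_seq; first exact: exec_pop.
  by apply: exec_if; apply: exec_skip.
rewrite /flush_cost; clear; nia.
Qed.

Lemma encode_vars_enc xs : encode_vars xs = enc (map digits xs).
Proof. by rewrite /enc -map_comp. Qed.

Lemma size_encode_vars xs : size xs <= size (encode_vars xs).
Proof. by elim: xs => //= x xs ih; rewrite ltnS size_cat (leq_trans ih) // leq_addl. Qed.

Lemma encode_vars_tokens xs :
  all (fun c => var_token (Some c)) (encode_vars xs).
Proof.
elim: xs => //= x xs ih; rewrite all_cat ih andbT.
by apply: sub_all (digits_bits x); case.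
Qed.

Lemma digits_le x M : size (digits x) <= M -> word_le M (digits x).
Proof.
by move=> le; apply/andP; split=> //; apply: sub_all (digits_bits x); case.
Qed.

Lemma encode_vars_le xs M : size (encode_vars xs) <= M ->
  {in xs, forall x, word_le M (digits x)}.
Proof.
elim: xs => //= x xs ih; rewrite size_cat -/(encode_vars xs) => le y; rewrite inE => /orP[/eqP ->|].
  by apply: digits_le; lia.
by apply: ih; lia.
Qed.

Definition atom_words (phi : formula) : seq (word * word) :=
  [seq (word_of p.1, word_of p.2) | p <- atom_pairs phi].

Lemma atom_words_le phi M : size (encode phi) <= M ->
  all (pair_le M) (const_pairs const_word ++ atom_words phi) &&
  (size (atom_words phi) <= M).
Proof.
move=> le; have M0 : 0 < M by apply: leq_trans le; case: phi => //= *; rewrite size_cat addnS.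
have wc b : word_le M (const_word b) by case: b.
have wcp : all (pair_le M) (const_pairs const_word) by rewrite /= /pair_le !wc.
rewrite all_cat wcp /=; case: phi le => /=.
- by rewrite /pair_le !wc.
- by rewrite /pair_le !wc.
- by move=> x le; rewrite /pair_le !wc digits_le //= ltnW.
- by move=> x le; rewrite /pair_le !wc digits_le //=; lia.
- move=> n xs ys; rewrite size_cat /= => le; apply/andP; split.
    apply/allP => _ /mapP [p /mem_zip [/mapP [x xin ->] /mapP [y yin ->]] ->] /=.
    by apply/andP; split; [apply: encode_vars_le xin | apply: encode_vars_le yin]; lia.
  rewrite !size_map size_zip !size_map; apply: leq_trans (geq_minl _ _) _.
  by apply: leq_trans (size_encode_vars _) _; lia.
- by [].
- by [].
Qed.

Lemma clauses_words phi acc : (if phi is FAnd _ _ then False else True) ->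
  map (map_clause word_of) (clauses phi acc) =
  if atom_words phi is [::] then map (map_clause word_of) acc
  else gen (const_pairs const_word ++ atom_words phi)
           (map (map_clause word_of) acc).
Proof.
move=> na; rewrite /atom_words.
have -> : clauses phi acc = if atom_pairs phi is [::] then acc
         else gen (const_pairs inr ++ atom_pairs phi) acc by case: phi na.
by case: (atom_pairs phi) => // p ps; rewrite gen_map.
Qed.

Definition enc_terms (K : seq (clause term)) : seq token :=
  enc_clauses (map (map_clause word_of) K).

Definition scan_cost (M : nat) : nat := flush_cost M + 20.

Lemma exec_scan_atom phi s r acc n S' M : disj_free phi ->
  (if phi is FAnd _ _ then False else True) -> separator s ->
  size (encode phi) <= M ->
  exec Scan (scan_state r [::] [::] (enc_terms (clauses phi acc))) n S' ->
  exec Scan (scan_state (encode phi ++ s :: r) [::] [::] (enc_terms acc))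
    (n + flush_cost M + 7 + 5 * size (encode phi) + 10) S'.
Proof.
move=> df na sep le; rewrite {1}/enc_terms clauses_words //.
have /andP[wps psM] := atom_words_le le.
have {}wps : all (pair_le M) (atom_words phi).
  by move: wps; rewrite all_cat => /andP[].
have flush := @exec_scan_sep s r (atom_words phi) (map (map_clause word_of) acc)
  _ n S' M sep _ psM wps.
case: phi le df na psM wps flush => //=.
- move=> _ _ _ _ _ /(_ [::] isT (or_intror (conj erefl erefl))) flush /flush e.
  apply: exec_le; first apply: exec_scan_step e => //.
    apply: exec_if => /=; apply: exec_if => /=; run exec_push.
    exact: (@exec_mov _ 0 1 TkTop (s :: r)).
  by clear; lia.
- move=> _ _ _ _ _ /(_ [::] isT (or_intror (conj erefl erefl))) flush /flush e.
  apply: exec_le; first apply: exec_scan_step e => //.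
    apply: exec_if => /=; apply: exec_if => /=; run exec_push.
    exact: (@exec_mov _ 0 1 TkBot (s :: r)).
  by clear; lia.
- move=> x _ _ _ _ _ /(_ [::] isT (or_intror (conj erefl erefl))) flush /flush e.
  apply: exec_le.
    apply: (@exec_scan_vars (encode_var x)).
      by have := encode_vars_tokens [:: x]; rewrite /= cats0.
    by rewrite cats0; move: e; rewrite /atom_words /= /enc /= cats0; apply.
  by rewrite /=; clear; lia.
- move=> x _ _ _ _ _ /(_ _ isT (or_introl erefl)) flush /flush e.
  apply: exec_le.
    apply: exec_scan_step; first by [].
      apply: exec_if => /=; apply: exec_if => /=; apply: exec_if => /=.
      run exec_pop; exact: (@exec_pushes 2).
    apply: (@exec_scan_vars (encode_var x)).
      by have := encode_vars_tokens [:: x]; rewrite /= cats0.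
    by rewrite cats0; move: e; rewrite /atom_words /= /enc /= cats0; apply.
  by rewrite /=; clear; lia.
- move=> m xs ys _ _ _ _ _ flush e.
  rewrite -catA /=; apply: exec_le.
    apply: exec_scan_vars; first exact: encode_vars_tokens.
    apply: exec_scan_step; first by [].
      do 3 (apply: exec_if => /=); apply: exec_if => /=.
      run exec_pop.
      apply: (@exec_move var_token 0 2 _ (encode_vars ys) (s :: r)) => //.
        exact: encode_vars_tokens.
      by case: (s) sep.
    rewrite /= !cats0.
    (* The bound is fixed before the case distinction, so that it serves both the empty and the
       nonempty list of pairs. *)
    instantiate (1 := n + flush_cost M + 7).
    have sxy : size xs = size ys by rewrite !size_tuple.
    have -> : encode_vars xs = enc (unzip1 (atom_words (FInc xs ys))).
      rewrite encode_vars_enc /atom_words /= /unzip1 -map_comp.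
      rewrite (map_comp word_of fst) -/(unzip1 _) unzip1_zip ?size_map ?sxy //.
      by rewrite -map_comp.
    have -> : encode_vars ys = enc (unzip2 (atom_words (FInc xs ys))).
      rewrite encode_vars_enc /atom_words /= /unzip2 -map_comp.
      rewrite (map_comp word_of snd) -/(unzip2 _) unzip2_zip ?size_map ?sxy //.
      by rewrite -map_comp.
    case: (atom_words _) flush e => [|p ps] flush e.
      exact: exec_scan_sep0.
    by apply: flush => //; left.
  rewrite !size_cat /=; clear; lia.
Qed.

(** The separator s flushes the last atom. Within a conjunction this role falls to [TkAnd] for the
    first conjunct and to [TkClose] for the second. *)
Lemma exec_scan phi s r acc n S' M : disj_free phi -> separator s ->
  size (encode phi) <= M ->
  exec Scan (scan_state r [::] [::] (enc_terms (clauses phi acc))) n S' ->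
  exec Scan (scan_state (encode phi ++ s :: r) [::] [::] (enc_terms acc))
    (n + (size (encode phi)).+1 * scan_cost M) S'.
Proof.
elim: phi s r acc n => [||x|x|m xs ys|phi1 ih1 phi2 ih2|] s r acc n // df sep le e;
  do ?[by apply: exec_le (exec_scan_atom df _ sep le e) _ => //;
       rewrite /scan_cost; set C := flush_cost M; move: (size (encode _)) => z;
       clear; nia].
move: df le e => /= /andP[df1 df2]; rewrite !size_cat /= size_cat /= => le e.
(* The run is built from its end: first s, which finds nothing pending after the closing bracket,
   then the second conjunct, then the first. *)
have e0 := exec_scan_sep0 M sep e.
have e2 := ih2 TkClose (s :: r) (clauses phi1 acc) _ df2 isT _ e0.
have le2 : size (encode phi2) <= M by clear -le; lia.
have le1 : size (encode phi1) <= M by clear -le; lia.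
have e1 := ih1 TkAnd _ acc _ df1 isT le1 (e2 le2).
have -> : (encode phi1 ++ TkAnd :: encode phi2 ++ [:: TkClose]) ++ s :: r =
  encode phi1 ++ TkAnd :: encode phi2 ++ TkClose :: s :: r.
  by do !rewrite -catA /=.
apply: exec_le.
  apply: exec_scan_step e1; first by [].
  do 5 (apply: exec_if => /=); exact: exec_pop.
rewrite /scan_cost; set C := flush_cost M; clear; nia.
Qed.

(** * The decision procedure *)

Notation word_clauses phi acc := (map (map_clause word_of) (clauses phi acc)).

Lemma clauses_le phi acc M : size (encode phi) <= M ->
  all (clause_le M) (map (map_clause word_of) acc) ->
  all (clause_le M) (word_clauses phi acc).
Proof.
elim: phi acc => [||x|x|n xs ys|phi1 ih1 phi2 ih2|phi1 _ phi2 _] acc le wacc;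
  do ?[have /andP[wps _] := atom_words_le le;
       by rewrite clauses_words //; case: (atom_words _) wps => // *;
          apply: all_gen].
by move: le; rewrite /= !size_cat /= size_cat /= => le; apply: ih2; last apply: ih1;
  rewrite // ; clear -le; lia.
Qed.

(** An atom has at most M pairs; with the two constant pairs they yield at most [(M + 2) * (M + 2)]
    clauses. *)
Lemma size_clauses phi acc M : size (encode phi) <= M ->
  size (clauses phi acc) <= size acc + size (encode phi) * ((M + 2) * (M + 2)).
Proof.
have base psi acc' : size (encode psi) <= M ->
  (if psi is FAnd _ _ then False else True) ->
  size (clauses psi acc') <= size acc' + size (encode psi) * ((M + 2) * (M + 2)).
  move=> le na; rewrite -(size_map (map_clause word_of)) clauses_words //.
  have /andP[_ sps] := atom_words_le le.
  have e0 : 0 < size (encode psi) by case: (psi) => //= *; rewrite size_cat addnS.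
  case: (atom_words psi) sps => [|p ps] sps; first by rewrite size_map leq_addr.
  apply: leq_trans (size_gen _ _) _; rewrite size_map size_cat leq_add2l.
  move: sps e0; move: (size (_ :: _)) (size (encode psi)) => z y; clear.
  rewrite /=; nia.
elim: phi acc => [||x|x|n xs ys|phi1 ih1 phi2 ih2|phi1 _ phi2 _] acc le;
  try exact: base.
move: le; rewrite /= !size_cat /= size_cat /= => le.
have le1 : size (encode phi1) <= M by clear -le; lia.
have le2 : size (encode phi2) <= M by clear -le; lia.
have := ih2 (clauses phi1 acc) le2; have := ih1 acc le1.
set C := (M + 2) * (M + 2); clear; nia.
Qed.

Lemma size_encode_gt0 phi : 0 < size (encode phi).
Proof. by case: phi => //= *; rewrite size_cat addnS. Qed.

(* The goal clause carries the question whether true = false is derived. It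
   lies below all other clauses, so it is only examined once no other clause
   fires. *)
Definition goal : clause term := ((inr true, inr false), (inr true, inr false)).

(** Moving the input to stack 4 and back serves to put a separator after it, so that its last atom
    is flushed as well. *)
Definition Decide : cmd :=
  While (on 0 filled) (Mov 0 4) ;; Push 0 TkClose ;;
  While (on 4 filled) (Mov 4 0) ;;
  Pushes 8 (enc_terms [:: goal]) ;; Scan ;; Solve.

(** Here [K] bounds the number of clauses; no word in them is longer than the input, hence the
    argument N of [solve_cost]. *)
Definition run_time (N : nat) : nat :=
  let K := N * ((N + 2) * (N + 2)) in
  10 * N + 40 + (N + 1) * scan_cost N +
  (K * (K + 2) + K + 1) * (solve_cost (K + 1) N + 1).

Lemma exec_decide phi : disj_free phi -> exists b S', [/\
  exec Decide (encode phi :: nseq 8 [::]) (run_time (size (encode phi))) S',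
  nth [::] S' 4 = if b then [::] else [:: TkX]
  & b <-> satisfiable phi].
Proof.
move=> df; set w := encode phi; set N := size w.
pose K := word_clauses phi [::].
have N0 : 0 < N := size_encode_gt0 phi.
have wK : all (clause_le N) K by apply: clauses_le.
have wg : clause_le N (map_clause word_of goal).
  by rewrite /clause_le /= /word_le /= N0.
have sK : size K <= N * ((N + 2) * (N + 2)).
  by rewrite size_map; apply: leq_trans (size_clauses [::] (leqnn _)) _.
have [b [S' [ex e4 hb]]] := @exec_solve N (N * ((N + 2) * (N + 2))) (size K)
  [::] K (map_clause word_of goal) erefl sK wK wg isT.
exists b, S'; split=> //; last first.
  apply: iff_trans hb _; apply: iff_trans (iff_sym (satisfiable_consistent df)).
  exact: (consistent_map _ (inr true) (inr false) word_ofK).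
have eK : rcons K (map_clause word_of goal) = word_clauses phi [:: goal].
  by rewrite -[[:: goal]]cat0s clauses_cat map_cat cats1.
rewrite eK in ex.
have es : exec Scan (scan_state [::] [::] [::] (enc_terms (clauses phi [:: goal])))
  1 (scan_state [::] [::] [::] (enc_terms (clauses phi [:: goal]))).
  exact: exec_while_end.
apply: exec_le.
  run (@exec_move filled 0 4 _ w [::]).
  run exec_push.
  run (@exec_move filled 4 0 _ (rev w) [::]).
  apply: exec_seq; first exact: exec_pushes.
  rewrite /=; apply: exec_seq; last exact: ex.
  exact: (exec_scan df (isT : separator TkClose) (leqnn _) es).
rewrite /run_time !size_rev -/w -/N; move: sK; set M := N * _.
set C := solve_cost _ _; set D := scan_cost _; move: (size K) => k.
clear => sK; have -> : size (enc_terms [:: goal]) = 8 by [].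
nia.
Qed.

(** * Polynomial bounds and the conclusion *)

Definition polynomial (f : nat -> nat) : Prop :=
  exists p : {poly nat}, forall n, (p.[n])%R = f n.

Lemma polynomial_const c : polynomial (fun=> c).
Proof. by exists (c%:P)%R => n; rewrite hornerC. Qed.

Lemma polynomial_id : polynomial (fun n => n).
Proof. by exists 'X%R => n; rewrite hornerX. Qed.

Lemma polynomialD f g :
  polynomial f -> polynomial g -> polynomial (fun n => f n + g n).
Proof. by move=> [p hp] [q hq]; exists (p + q)%R => n; rewrite hornerD hp hq. Qed.

Lemma polynomialM f g :
  polynomial f -> polynomial g -> polynomial (fun n => f n * g n).
Proof. by move=> [p hp] [q hq]; exists (p * q)%R => n; rewrite hornerM hp hq. Qed.

Lemma run_time_polynomial : polynomial run_time.
Proof.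
rewrite /run_time /scan_cost /flush_cost /solve_cost; cbv zeta.
by repeat first [exact: polynomial_id | exact: polynomial_const
  | apply: polynomialD | apply: polynomialM].
Qed.

Theorem theorem5 :
  polytime_decidable encode (fun phi : formula => disj_free phi) satisfiable.
Proof.
(* The added 1 pays for the step that computes the answer from the final tops. *)
have [p hp] := polynomialD run_time_polynomial (polynomial_const 1).
(* Eight extra tapes provide the stacks 0 to 8; the answer is positive when stack 4 carries no
   mark. *)
exists (compile 8 Decide (fun o => ~~ filled (nth None o 4))), p.
move=> phi df; have [b [S' [ex e4 hb]]] := exec_decide df; exists b => //.
rewrite (compile_outcome _ ex); last by rewrite hp addn1.
congr Some; have -> : nth None (map ohead S') 4 = ohead (nth [::] S' 4).
  by rewrite (nth_map [::]) // (exec_size ex).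
by rewrite e4; case: (b).
Qed.
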